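(* Suppose there exists an integer $d\ge 3$ with the following property: for every integer $p\ge 1$ there exists an integer $k_0(d,p)$ such that for all $k\ge k_0(d,p)$ the constant function $\mathbf{1}$ on $\mathcal{C}_k^{(d)}$ lies in the linear span $\mathrm{span}\{\mathbf{1}_{\mathcal{S}} : \mathcal{S} \text{ is a length-}p\text{ shuffle class in } \mathcal{C}_k^{(d)}\}$ (i.e. there are real numbers $\lambda_{\mathcal{S}}$ with $\sum_{\mathcal{S}}\lambda_{\mathcal{S}}\mathbf{1}_{\mathcal{S}}(T)=1$ for every $T\in\mathcal{C}_k^{(d)}$). Then the Jacobian conjecture holds: for every $n\ge 1$, every Keller map $F:\mathbb{C}^n\to\mathbb{C}^n$ is a polynomial automorphism.
   Context: For an integer $d\ge 2$, a $d$-Catalan tree is a rooted planar tree (children of each vertex ordered left to right) in which every vertex has either $0$ or $d$ children; vertices with $d$ children are internal, the others are leaves. $\mathcal{C}_k^{(d)}$ denotes the set of $d$-Catalan trees with $k$ internal vertices. An (ancestral) path of length $p$ is a sequence of vertices $(v_0,\dots,v_p)$ with $v_i$ a child of $v_{i-1}$. For $1\le i\le p$, $v_i$ has $d-1$ siblings $w_{i,1},\dots,w_{i,d-1}$, each subtending a subtree $W_{i,j}$ (the vertex $w_{i,j}$ and all its descendants). The shuffle class $\mathrm{Sh}(T;v_0,\dots,v_p)\subseteq\mathcal{C}_k^{(d)}$ of $T\in\mathcal{C}_k^{(d)}$ is the set of all trees obtainable from $T$ by rearranging the $(d-1)p$ subtrees $W_{i,j}$ among the $(d-1)p$ sibling positions,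 keeping everything else fixed. A length-$p$ shuffle class in $\mathcal{C}_k^{(d)}$ is any set of this form; $\mathbf{1}_{\mathcal{S}}$ is its indicator function on $\mathcal{C}_k^{(d)}$. A polynomial mapping $F=(F_1,\dots,F_n):\mathbb{C}^n\to\mathbb{C}^n$ (each $F_i\in\mathbb{C}[X_1,\dots,X_n]$) is a Keller map if $\det JF$, where $(JF)_{i,j}=\partial F_i/\partial X_j$, is a nonzero constant; it is a polynomial automorphism if there is a polynomial mapping $G$ with $F\circ G=G\circ F=\mathrm{id}$. *)

(* Defs.v *)
From HB Require Import structures.
From mathcomp Require Import all_boot all_algebra fingroup perm.
From mathcomp Require Import Rstruct.
From mathcomp Require Import complex.
From mathcomp Require Import mpoly.

Set Implicit Arguments.
Unset Strict Implicit.
Unset Printing Implicit Defensive.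

Import GRing.Theory.

Inductive tree : Type := Leaf | Node of seq tree.

Fixpoint tree_enc (t : tree) : GenTree.tree unit :=
  match t with
  | Leaf => GenTree.Leaf tt
  | Node cs => GenTree.Node 0 (map tree_enc cs)
  end.

Fixpoint tree_dec (g : GenTree.tree unit) : tree :=
  match g with
  | GenTree.Leaf _ => Leaf
  | GenTree.Node _ gs => Node (map tree_dec gs)
  end.

Fixpoint tree_encK (t : tree) : tree_dec (tree_enc t) = t :=
  match t return tree_dec (tree_enc t) = t with
  | Leaf => erefl
  | Node cs => f_equal Node
      ((fix aux (cs : seq tree) : map tree_dec (map tree_enc cs) = cs :=
          match cs return map tree_dec (map tree_enc cs) = cs with
          | [::] => erefl
          | c :: cs' => f_equal2 cons (tree_encK c) (aux cs')
          end) cs)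
  end.

HB.instance Definition _ := Countable.copy tree (can_type tree_encK).

Fixpoint is_dcat (d : nat) (t : tree) : bool :=
  match t with
  | Leaf => true
  | Node cs => (size cs == d) && all (is_dcat d) cs
  end.

Fixpoint internal (t : tree) : nat :=
  match t with
  | Leaf => 0
  | Node cs => (sumn (map internal cs)).+1
  end.

Definition dcat (d k : nat) (t : tree) : bool := is_dcat d t && (internal t == k).

(* Vertices are addressed by the sequence of child indices from the root.
   subtree t a = the subtree rooted at the vertex with address a (if any). *)
Fixpoint subtree (t : tree) (a : seq nat) : option tree :=
  match a with
  | [::] => Some t
  | j :: a' =>
      if t is Node cs then
        (if j < size cs then subtree (nth Leaf cs j) a' else None)
      else None
  end.

Fixpoint replace (t : tree) (a : seq nat) (s : tree) : tree :=
  match a with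
  | [::] => s
  | j :: a' =>
      if t is Node cs then
        (if j < size cs then Node (set_nth Leaf cs j (replace (nth Leaf cs j) a' s))
         else t)
      else t
  end.

(* An ancestral path (v_0, ..., v_p) in t is encoded by the address v0 of v_0
   and the list ds = [c_1; ...; c_p] of child indices: v_i = v0 ++ take i ds.
   It is a genuine path of t iff the vertex v_p exists. *)
Definition valid_path (t : tree) (v0 ds : seq nat) : bool :=
  subtree t (v0 ++ ds) != None.

(* The (d-1)p sibling positions w_{i,j}: the children of v_{i-1} other than v_i. *)
Definition sib_positions (d : nat) (v0 ds : seq nat) : seq (seq nat) :=
  [seq v0 ++ rcons (take i ds) j
     | i <- iota 0 (size ds), j <- [seq j <- iota 0 d | j != nth 0 ds i]].

Definition rearrange (t : tree) (P : seq (seq nat)) (f : nat -> nat) : tree :=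
  foldl (fun acc q =>
           replace acc (nth [::] P q) (odflt Leaf (subtree t (nth [::] P (f q)))))
        t (iota 0 (size P)).

Definition shuffle_class (d : nat) (T : tree) (v0 ds : seq nat) : pred tree :=
  let P := sib_positions d v0 ds in
  fun T' => [exists s : 'S_(size P),
               T' == rearrange T P
                       (fun q => oapp (fun i : 'I_(size P) => val (s i)) q (insub q))].

Definition is_shuffle_class (d k p : nat) (S : pred tree) : Prop :=
  exists (T : tree) (v0 ds : seq nat),
    [/\ dcat d k T, size ds = p, valid_path T v0 ds & S =1 shuffle_class d T v0 ds].

Definition one_in_shuffle_span (d k p : nat) : Prop :=
  exists (m : nat) (S : 'I_m -> pred tree) (lam : 'I_m -> Rdefinitions.R),
    (forall i, is_shuffle_class d k p (S i)) /\
    (forall T, dcat d k T -> (\sum_(i < m) lam i * ((S i T : bool)%:R) = 1)%R).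

Notation CC := (complex Rdefinitions.R).

Local Open Scope ring_scope.

Definition jacobian (n : nat) (F : 'I_n -> {mpoly CC[n]}) : 'M[{mpoly CC[n]}]_n :=
  \matrix_(i < n, j < n) mderiv j (F i).

Definition keller_map (n : nat) (F : 'I_n -> {mpoly CC[n]}) : Prop :=
  exists c : CC, c != 0 /\ \det (jacobian F) = c%:MP.

Definition pcomp (n : nat) (F G : 'I_n -> {mpoly CC[n]}) : 'I_n -> {mpoly CC[n]} :=
  fun i => comp_mpoly [tuple G j | j < n] (F i).

Definition poly_automorphism (n : nat) (F : 'I_n -> {mpoly CC[n]}) : Prop :=
  exists G : 'I_n -> {mpoly CC[n]},
    (forall i, pcomp F G i = 'X_i) /\ (forall i, pcomp G F i = 'X_i).

(* Main.v *)
Require Import Defs.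
From HB Require Import structures.
From mathcomp Require Import all_boot all_algebra all_fingroup.
From mathcomp Require Import Rstruct complex mpoly ring zify.

Set Implicit Arguments.
Unset Strict Implicit.
Unset Printing Implicit Defensive.

Import GRing.Theory Num.Theory.
Local Open Scope ring_scope.

(** Over an algebraically closed field the Keller condition is only used pointwise: the
    derivative of the map is injective at every point.  This property survives the
    classical stabilization steps, which turn [x + (terms of order at least 2)] first into a
    map of degree 3, then, with one more variable [t] as homogenizing parameter, into
    [x + H(x)] with [H] homogeneous of degree [d], and Waring's formula writes [H] as a sum of
    d-th powers of linear forms times vectors.  Injectivity of [1 + s^(d-1) DH(x)] for all
    scalars [s] leaves no nonzero eigenvalue to [DH(x)], which is therefore nilpotent.

    The formal right inverse of [x + H(x)] is the sum over d-Catalan trees of the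
    compositions of the polarization of [-H] that they describe.  The sum over all
    shuffles along a path of length [p] is the full polarization of [DH(x)^p = 0], so it
    vanishes; if 1 is a combination of indicators of shuffle classes, the sum over all
    trees with [k] internal vertices vanishes too, for all large [k], and the formal
    inverse is polynomial.

    Hence every Keller map [F] has a polynomial right inverse [G].  By the chain rule [G] is a
    Keller map, so it has a right inverse as well, which has to be [F]. *)

Notation dual V := 'Hom(V, _^o).

(** * Polynomial maps as lists of monomials *)

Section PolyMaps.
Variables (K : numClosedFieldType) (V : vectType K).
Implicit Types (s : seq (dual V)) (x h : V).

(** A monomial is a list of linear forms with repetition: its degree is [size s], and a linear
    change of variables acts entry by entry, without any choice of basis. *)
Definition mev s x : K := \prod_(l <- s) (l x : K).

(** The derivative of the monomial at [x] in the direction [h], by the product rule. *)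
Fixpoint dmev s x h : K :=
  if s is l :: s' then (l h : K) * mev s' x + (l x : K) * dmev s' x h else 0.

Lemma mev_nil x : mev [::] x = 1.
Proof. by rewrite /mev big_nil. Qed.

Lemma mev_cons l s x : mev (l :: s) x = (l x : K) * mev s x.
Proof. by rewrite /mev big_cons. Qed.

Lemma mev_cat s1 s2 x : mev (s1 ++ s2) x = mev s1 x * mev s2 x.
Proof. by rewrite /mev big_cat. Qed.

Lemma dualD (l : dual V) x h : l (x + h) = (l x : K) + (l h : K) :> K.
Proof. by rewrite linearD. Qed.

Lemma dualZ (l : dual V) c x : l (c *: x) = c * (l x : K) :> K.
Proof. by rewrite linearZ. Qed.

Lemma mevZ s c x : mev s (c *: x) = c ^+ size s * mev s x.
Proof.
elim: s => [|l s IH]; first by rewrite !mev_nil mulr1.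
by rewrite !mev_cons IH dualZ exprS mulrACA.
Qed.

Lemma mev_nseq n l x : mev (nseq n l) x = (l x : K) ^+ n.
Proof. by rewrite /mev big_nseq iter_mulr_1. Qed.

Lemma dmev_cat s1 s2 x h :
  dmev (s1 ++ s2) x h = dmev s1 x h * mev s2 x + mev s1 x * dmev s2 x h.
Proof.
elim: s1 => [|l s IH] /=; first by rewrite mev_nil; ring.
by rewrite IH mev_cat mev_cons; ring.
Qed.

Lemma dmevZ s c x h : dmev s (c *: x) h = c ^+ (size s).-1 * dmev s x h.
Proof.
elim: s => [|l s IH] /=; first by rewrite mulr0.
rewrite IH mevZ dualZ; case: s {IH} => [|l' s] /=; first by ring.
by rewrite exprS; ring.
Qed.

Lemma dmevP s x c h h' : dmev s x (c *: h + h') = c * dmev s x h + dmev s x h'.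
Proof.
elim: s => [|l s IH] /=; first by rewrite mulr0 addr0.
by rewrite IH dualD dualZ; ring.
Qed.

Lemma dmev_nseq n l x h :
  dmev (nseq n l) x h = n%:R * ((l x : K) ^+ n.-1 * (l h : K)).
Proof.
elim: n => [|n IH] /=; first by rewrite mul0r.
rewrite IH mev_nseq; case: n {IH} => [|n] /=; first by ring.
by rewrite exprS -(natr1 n.+1) /=; ring.
Qed.

Variable W : vectType K.
Implicit Type L : seq (W * seq (dual V)).

Definition Ev L x : W := \sum_(m <- L) mev m.2 x *: m.1.
Definition DEv L x h : W := \sum_(m <- L) dmev m.2 x h *: m.1.

Lemma Ev_nil x : Ev [::] x = 0. Proof. exact: big_nil. Qed.
Lemma DEv_nil x h : DEv [::] x h = 0. Proof. exact: big_nil. Qed.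
Lemma Ev_cons m L x : Ev (m :: L) x = mev m.2 x *: m.1 + Ev L x.
Proof. exact: big_cons. Qed.
Lemma DEv_cons m L x h : DEv (m :: L) x h = dmev m.2 x h *: m.1 + DEv L x h.
Proof. exact: big_cons. Qed.
Lemma Ev_cat L1 L2 x : Ev (L1 ++ L2) x = Ev L1 x + Ev L2 x.
Proof. by rewrite /Ev big_cat. Qed.
Lemma DEv_cat L1 L2 x h : DEv (L1 ++ L2) x h = DEv L1 x h + DEv L2 x h.
Proof. by rewrite /DEv big_cat. Qed.
Lemma Ev_perm L1 L2 x : perm_eq L1 L2 -> Ev L1 x = Ev L2 x.
Proof. exact: perm_big. Qed.
Lemma DEv_perm L1 L2 x h : perm_eq L1 L2 -> DEv L1 x h = DEv L2 x h.
Proof. exact: perm_big. Qed.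

Lemma DEv_is_linear L x : linear (DEv L x).
Proof.
move=> c h h'; rewrite /DEv scaler_sumr -big_split /=; apply: eq_bigr => m _.
by rewrite dmevP scalerDl scalerA.
Qed.

HB.instance Definition _ L x := GRing.isLinear.Build K V W _ (DEv L x) (DEv_is_linear L x).

Lemma DEvZ n L c x h :
  all (fun m => size m.2 == n) L -> DEv L (c *: x) h = c ^+ n.-1 *: DEv L x h.
Proof.
move/allP=> sL; rewrite /DEv scaler_sumr big_seq [RHS]big_seq; apply: eq_bigr => m /sL /eqP sm.
by rewrite dmevZ sm scalerA.
Qed.

End PolyMaps.

(** Generation from constants and linear forms avoids coordinates; closure under pointwise equality
    stands in for functional extensionality. *)
Inductive ispoly (K : numClosedFieldType) (V : vectType K) : (V -> K) -> Prop :=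
| ispoly_const c : ispoly (fun=> c)
| ispoly_lin (l : dual V) : ispoly (fun x => l x)
| ispolyD f g : ispoly f -> ispoly g -> ispoly (fun x => f x + g x)
| ispolyM f g : ispoly f -> ispoly g -> ispoly (fun x => f x * g x)
| ispoly_ext f g : f =1 g -> ispoly f -> ispoly g.

Definition polymap (K : numClosedFieldType) (V W : vectType K) (f : V -> W) :=
  forall l : dual W, ispoly (fun x => l (f x)).

Section PolymapTheory.
Variables (K : numClosedFieldType).
Implicit Types (U V W : vectType K).

Lemma ispoly_comp V W (f : W -> K) (g : V -> W) :
  ispoly f -> polymap g -> ispoly (fun x => f (g x)).
Proof.
move=> Pf Pg; elim: Pf => [c|l|f1 f2 _ I1 _ I2|f1 f2 _ I1 _ I2|f1 f2 e _ I].
- exact: ispoly_const.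
- exact: Pg.
- exact: ispolyD.
- exact: ispolyM.
by apply: ispoly_ext I => x /=; rewrite e.
Qed.

Lemma polymap_comp U V W (f : V -> W) (g : U -> V) :
  polymap f -> polymap g -> polymap (fun x => f (g x)).
Proof. by move=> Pf Pg l; apply: (ispoly_comp (Pf l)). Qed.

Lemma polymap_ext V W (f g : V -> W) : f =1 g -> polymap f -> polymap g.
Proof. by move=> e Pf l; apply: ispoly_ext (Pf l) => x; rewrite e. Qed.

Lemma polymap_cst V W (w : W) : polymap (fun _ : V => w).
Proof. by move=> l; apply: ispoly_const. Qed.

Lemma polymap_hom V W (f : 'Hom(V, W)) : polymap f.
Proof.
by move=> l; apply: ispoly_ext (ispoly_lin (l \o f)%VF) => x; rewrite comp_lfunE.
Qed.

Lemma polymapD V W (f g : V -> W) : polymap f -> polymap g -> polymap (fun x => f x + g x).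
Proof.
by move=> Pf Pg l; apply: ispoly_ext (ispolyD (Pf l) (Pg l)) => x; rewrite linearD.
Qed.

Lemma polymapZ V W (f : V -> K) (g : V -> W) :
  ispoly f -> polymap g -> polymap (fun x => f x *: g x).
Proof.
by move=> Pf Pg l; apply: ispoly_ext (ispolyM Pf (Pg l)) => x; rewrite linearZ.
Qed.

Lemma polymap_sum V W (I : Type) (r : seq I) (f : I -> V -> W) :
  (forall i, polymap (f i)) -> polymap (fun x => \sum_(i <- r) f i x).
Proof.
move=> Pf; elim: r => [|i r IH].
  by apply: polymap_ext (polymap_cst V (0 : W)) => x; rewrite big_nil.
by apply: polymap_ext (polymapD (Pf i) IH) => x; rewrite big_cons.
Qed.

End PolymapTheory.

(* Here a list [L] of monomials stands for the map [x |-> x + Ev L x]. *)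
Definition pkeller (K : numClosedFieldType) (V : vectType K) (L : seq (V * seq (dual V))) :=
  forall x h, h + DEv L x h = 0 -> h = 0.

(** A right inverse is enough at this stage: two-sidedness is recovered at the end by inverting the
    right inverse once more. *)
Definition rinv (K : numClosedFieldType) (V : vectType K) (L : seq (V * seq (dual V))) :=
  exists2 G : V -> V, polymap G & forall u, G u + Ev L (G u) = u.

Lemma hom_sep (K : numClosedFieldType) (V : vectType K) (v w : V) :
  (forall l : dual V, l v = l w) -> v = w.
Proof.
move=> H; rewrite (coord_vbasis (memvf v)) (coord_vbasis (memvf w)).
apply: eq_bigr => i _; congr (_ *: _).
by have := H (linfun (coord (vbasis fullv) i : V -> K^o)); rewrite !lfunE.
Qed.

(** * Lowering the degree to three *)

Section Pullback.
Variables (K : numClosedFieldType) (V V' : vectType K).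

Definition pull (p : 'Hom(V', V)) (s : seq (dual V)) : seq (dual V') :=
  [seq (l \o p)%VF | l <- s].

Lemma mev_pull p s x : mev (pull p s) x = mev s (p x).
Proof.
by elim: s => [|l s IH]; rewrite ?mev_nil //= !mev_cons IH comp_lfunE.
Qed.

Lemma dmev_pull p s x h : dmev (pull p s) x h = dmev s (p x) (p h).
Proof. by elim: s => [|l s IH] //=; rewrite IH mev_pull !comp_lfunE. Qed.

Variables (W W' : vectType K) (i : {linear W -> W'}) (p : 'Hom(V', V)).
Implicit Type L : seq (W * seq (dual V)).

Definition pullL L := [seq (i m.1, pull p m.2) | m <- L].

Lemma Ev_pull L x : Ev (pullL L) x = i (Ev L (p x)).
Proof.
by rewrite /Ev big_map linear_sum; apply: eq_bigr => m _; rewrite linearZ mev_pull.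
Qed.

Lemma DEv_pull L x h : DEv (pullL L) x h = i (DEv L (p x) (p h)).
Proof.
by rewrite /DEv big_map linear_sum; apply: eq_bigr => m _; rewrite linearZ dmev_pull.
Qed.
End Pullback.

Section PairHoms.
Variables (K : numClosedFieldType) (V W : vectType K).

Definition hfst : 'Hom((V * W)%type, V) := linfun fst.
Definition hsnd : 'Hom((V * W)%type, W) := linfun snd.
Lemma hfstE x : hfst x = x.1. Proof. by rewrite lfunE. Qed.
Lemma hsndE x : hsnd x = x.2. Proof. by rewrite lfunE. Qed.

Definition inl_vect (v : V) : (V * W)%type := (v, 0).
Lemma inl_vect_is_linear : linear inl_vect.
Proof. by move=> c u v; congr (_, _); rewrite /= scaler0 addr0. Qed.
HB.instance Definition _ :=
  GRing.isLinear.Build K V (V * W)%type _ inl_vect inl_vect_is_linear.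

Definition inr_vect (w : W) : (V * W)%type := (0, w).
Lemma inr_vect_is_linear : linear inr_vect.
Proof. by move=> c u v; congr (_, _); rewrite /= scaler0 addr0. Qed.
HB.instance Definition _ :=
  GRing.isLinear.Build K W (V * W)%type _ inr_vect inr_vect_is_linear.
End PairHoms.

Section ReduceStep.
Variables (K : numClosedFieldType) (V : vectType K).
Variables (e : V) (a b : seq (dual V)) (R : seq (V * seq (dual V))).

Let W : vectType K := ((V * K^o) * K^o)%type.
Let p : 'Hom(W, V) := (hfst V K^o \o hfst (V * K^o)%type K^o)%VF.
Let y : dual W := (hsnd V K^o \o hfst (V * K^o)%type K^o)%VF.
Let z : dual W := hsnd (V * K^o)%type K^o.
Let i : {linear V -> W} := @inl_vect K (V * K^o)%type K^o \o @inl_vect K V K^o.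

(* Composition of (x, y, z) |-> (x - y z e, y, z), F and (x, y, z) |-> (x, y + a, z + b):
   the monomial a b e is traded for (y z + y b + z a) e, a and b. *)
Definition split_monomial : seq (W * seq (dual W)) :=
  [:: (- i e, [:: y; z]); (- i e, y :: pull p b); (- i e, z :: pull p a);
      ((0, 1 : K^o, 0), pull p a); ((0, 0, 1 : K^o), pull p b)] ++ pullL i p R.

Let pE w : p w = w.1.1. Proof. by rewrite /p comp_lfunE !hfstE. Qed.
Let yE w : y w = w.1.2. Proof. by rewrite /y comp_lfunE hfstE hsndE. Qed.
Let zE w : z w = w.2. Proof. by rewrite /z hsndE. Qed.

Lemma Ev_split v (r t : K) : Ev split_monomial (v, r, t) =
  (Ev R v - (r * t + r * mev b v + t * mev a v) *: e, mev a v, mev b v).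
Proof.
rewrite Ev_cat Ev_pull pE !Ev_cons Ev_nil /= !mev_cons mev_nil !mev_pull pE yE zE /=.
rewrite mulr1 /i /= /inl_vect.
congr (_, _, _) => /=.
- by rewrite !scalerN !scaler0 !addr0 addrC !scalerDl !opprD !addrA.
- by rewrite !(oppr0, scaler0, addr0, add0r) /GRing.scale /= mulr1.
- by rewrite !(oppr0, scaler0, addr0, add0r) /GRing.scale /= mulr1.
Qed.

Lemma DEv_split v (r t : K) h (k l : K) : DEv split_monomial (v, r, t) (h, k, l) =
  (DEv R v h - (k * t + r * l + k * mev b v + r * dmev b v h + l * mev a v + t * dmev a v h) *: e,
   dmev a v h, dmev b v h).
Proof.
rewrite DEv_cat DEv_pull !pE !DEv_cons DEv_nil /= !mev_cons mev_nil !mev_pull !dmev_pull.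
rewrite !pE !yE !zE /=.
rewrite !mulr1 mulr0 addr0 /i /= /inl_vect.
congr (_, _, _) => /=.
- by rewrite !scalerN !scaler0 !addr0 addrC !scalerDl !opprD !addrA.
- by rewrite !(oppr0, scaler0, addr0, add0r) /GRing.scale /= mulr1.
- by rewrite !(oppr0, scaler0, addr0, add0r) /GRing.scale /= mulr1.
Qed.

(** The last two components determine [k] and [l]. After substitution the terms in [r] and [t]
    cancel, and the first component is the derivative of the original map applied to [h]. *)
Lemma pkeller_split : pkeller ((e, a ++ b) :: R) -> pkeller split_monomial.
Proof.
move=> kL [[v r] t] [[h k] l]; rewrite DEv_split => - [/= E1 E2 E3].
have Ek : k = - dmev a v h by apply/eqP; rewrite -addr_eq0; apply/eqP; exact: E2.
have El : l = - dmev b v h by apply/eqP; rewrite -addr_eq0; apply/eqP; exact: E3.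
suff h0 : h = 0.
  have d0 s : dmev s v 0 = 0.
    by have := dmevP s v (-1) 0 0; rewrite scaler0 addr0 mulN1r addNr.
  by rewrite Ek El h0 !d0 oppr0.
apply: (kL v); rewrite DEv_cons /= dmev_cat -[RHS]E1; congr (_ + _).
rewrite [LHS]addrC -scaleNr; congr (_ + _); congr (_ *: _); rewrite Ek El; ring.
Qed.

(** On inputs [(u, 0, 0)] the last two components force [r = -a(v)] and [t = -b(v)], so that
    [r t + r b + t a = -a b] restores the split monomial. *)
Lemma rinv_split : rinv split_monomial -> rinv ((e, a ++ b) :: R).
Proof.
case=> G PG EG; exists (fun u => p (G (i u))).
  apply: (polymap_comp (polymap_hom p)); apply: (polymap_comp PG).
  by apply: polymap_ext (polymap_hom (linfun i)) => u; rewrite lfunE.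
move=> u; have := EG (i u); rewrite pE; case: (G (i u)) => [[v r] t] /=.
rewrite Ev_split => - [/= E1 E2 E3].
have Er : r = - mev a v by apply/eqP; rewrite -addr_eq0; apply/eqP; exact: E2.
have Et : t = - mev b v by apply/eqP; rewrite -addr_eq0; apply/eqP; exact: E3.
rewrite -E1 Ev_cons /= mev_cat; congr (_ + _); rewrite addrC; congr (_ + _).
rewrite -scaleNr; congr (_ *: _); rewrite Er Et; ring.
Qed.

End ReduceStep.

(** Termination measure for the splitting. A monomial of degree [n + 2] with [n >= 2] leaves at most
    two monomials of degree above three, of degrees [n + 1] and [n], and
    [3^(n+1) + 3^n < 3^(n+2)]. *)
Definition weight (T U : Type) (L : seq (T * seq U)) : nat :=
  \sum_(m <- L | (3 < size m.2)%N) 3 ^ size m.2.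

Lemma reduce_to_cubic (K : numClosedFieldType) :
  (forall (V : vectType K) (L : seq (V * seq (dual V))),
     all (fun m => 1 < size m.2 <= 3)%N L -> pkeller L -> rinv L) ->
  forall (V : vectType K) (L : seq (V * seq (dual V))),
     all (fun m => 1 < size m.2)%N L -> pkeller L -> rinv L.
Proof.
move=> H V L; have [n] := ubnP (weight L); elim: n V L => // n IH V L /ltnSE wL sL kL.
have [/hasP[m mL sm]|/hasPn nL] := boolP (has (fun m => 3 < size m.2)%N L); last first.
  by apply: H kL; apply/allP => m mL; rewrite (allP sL m mL) leqNgt; apply: nL.
have := perm_to_rem mL; move: (rem m L) => R pe.
case: m mL sm pe => e s /= mL sm pe.
(* Splitting off exactly two forms leaves at least two, so every new monomial still has degree at
   least two. *)
case: s mL sm pe => [|l1 [|l2 s]] // mL sm pe.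
have kR : pkeller ((e, [:: l1; l2] ++ s) :: R).
  by move=> x h; rewrite -(DEv_perm _ _ pe); apply: kL.
suff [G PG EG] : rinv ((e, [:: l1; l2] ++ s) :: R).
  by exists G => // u; rewrite (Ev_perm _ pe).
apply: rinv_split; apply: IH (pkeller_split kR).
- apply: leq_trans wL; rewrite /weight (perm_big _ pe) /= !big_cons sm /=.
  rewrite !size_map big_map; under eq_bigl do rewrite /= size_map.
  under eq_bigr do rewrite /= size_map.
  move: (\sum_(j <- R | _) _)%N => w.
  have -> : (3 ^ (size s).+2 = 9 * 3 ^ size s)%N by rewrite !expnS mulnA.
  have -> : (3 ^ (size s).+1 = 3 * 3 ^ size s)%N by rewrite !expnS.
  have : (0 < 3 ^ size s)%N by rewrite expn_gt0.
  move: (3 ^ size s)%N => q q0.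
  by do 2!case: ifP => _; lia.
move: sL; rewrite (perm_all _ pe) /= !size_map all_map => sR.
have s2 : (1 < size s)%N := sm.
rewrite !ltnS (ltnW s2) s2 /=.
by apply: sub_all sR => m' /=; rewrite size_map.
Qed.

(** * Homogenization *)

Section Homogenize.
Variables (K : numClosedFieldType) (d : nat).
Hypothesis d_ge3 : (3 <= d)%N.

Section ScaleMonomials.
Variables (V W : vectType K) (t : dual V) (k : nat).
Implicit Type L : seq (W * seq (dual V)).

Definition tmul L := [seq (m.1, nseq k t ++ m.2) | m <- L].

Lemma Ev_tmul L x : Ev (tmul L) x = (t x : K) ^+ k *: Ev L x.
Proof.
rewrite /Ev big_map scaler_sumr; apply: eq_bigr => m _.
by rewrite mev_cat mev_nseq scalerA.
Qed.

Lemma DEv_tmul L x h : t h = 0 -> DEv (tmul L) x h = (t x : K) ^+ k *: DEv L x h.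
Proof.
move=> th; rewrite /DEv big_map scaler_sumr; apply: eq_bigr => m _.
by rewrite dmev_cat mev_nseq dmev_nseq th !mulr0 mul0r add0r scalerA.
Qed.
End ScaleMonomials.

Definition id_monomials (V : vectType K) : seq (V * seq (dual V)) :=
  [seq ((vbasis fullv)`_i, [:: linfun (coord (vbasis fullv) i : V -> K^o)])
     | i : 'I_(\dim {:V})].

Lemma Ev_id (V : vectType K) (x : V) : Ev (id_monomials V) x = x.
Proof.
rewrite /Ev big_image {2}(coord_vbasis (memvf x)); apply: eq_bigr => i _.
by rewrite /= mev_cons mev_nil mulr1 lfunE.
Qed.

Lemma DEv_id (V : vectType K) (x h : V) : DEv (id_monomials V) x h = h.
Proof.
rewrite /DEv big_image {2}(coord_vbasis (memvf h)); apply: eq_bigr => i _.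
by rewrite /= mev_nil mulr1 mulr0 addr0 lfunE.
Qed.

Variables (V : vectType K) (Q C : seq (V * seq (dual V))).
Hypothesis sQ : all (fun m => size m.2 == 2) Q.
Hypothesis sC : all (fun m => size m.2 == 3) C.

Let W : vectType K := ((V * V) * K^o)%type.
Let px : 'Hom(W, V) := (hfst V V \o hfst (V * V)%type K^o)%VF.
Let py : 'Hom(W, V) := (hsnd V V \o hfst (V * V)%type K^o)%VF.
Let t : dual W := hsnd (V * V)%type K^o.
Let i1 : {linear V -> W} := @inl_vect K (V * V)%type K^o \o @inl_vect K V V.
Let i2 : {linear V -> W} := @inl_vect K (V * V)%type K^o \o @inr_vect K V V.

Let pxE w : px w = w.1.1. Proof. by rewrite /px comp_lfunE !hfstE. Qed.
Let pyE w : py w = w.1.2. Proof. by rewrite /py comp_lfunE hfstE hsndE. Qed.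
Let tE w : t w = w.2. Proof. by rewrite /t hsndE. Qed.

(** The map is [(x + t^(d-2) Q(x) - t^(d-1) y, y + t^(d-3) C(x), t)]. Eliminating [y] gives [C] the
    factor [t^(2d-4)], the square of the factor of [Q], which is the effect on derivatives of
    scaling [x] by [t^(d-2)]; powers of [t] in front of [Q] and [C] alone would not match in this
    way. *)
Definition homogenization : seq (W * seq (dual W)) :=
  tmul t (d - 2) (pullL i1 px Q) ++ tmul t (d - 3) (pullL i2 px C)
  ++ tmul t d.-1 (pullL (-%R \o i1) py (id_monomials V)).

Lemma Ev_homogenization x y (s : K) : Ev homogenization (x, y, s) =
  (s ^+ (d - 2) *: Ev Q x - s ^+ d.-1 *: y, s ^+ (d - 3) *: Ev C x, 0).
Proof.
rewrite !Ev_cat !Ev_tmul !Ev_pull Ev_id pxE pyE tE /= /inl_vect /inr_vect.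
by congr (_, _, _); rewrite /= !(oppr0, scaler0, addr0, add0r, scalerN).
Qed.

Lemma DEv_homogenization x y (s : K) h k : DEv homogenization (x, y, s) (h, k, 0) =
  (s ^+ (d - 2) *: DEv Q x h - s ^+ d.-1 *: k, s ^+ (d - 3) *: DEv C x h, 0).
Proof.
rewrite !DEv_cat !DEv_tmul ?tE // !DEv_pull DEv_id !pxE !pyE /= /inl_vect /inr_vect.
by congr (_, _, _); rewrite /= !(oppr0, scaler0, addr0, add0r, scalerN).
Qed.

Lemma DEv_homogenization_t w h : (DEv homogenization w h).2 = 0.
Proof.
rewrite /DEv (big_morph (fun w : W => w.2) (fun _ _ => erefl) erefl).
rewrite big_seq big1 // => m; rewrite !mem_cat /tmul /pullL -!map_comp.
by case/or3P=> /mapP[m' _ ->] /=; rewrite ?oppr0 scaler0.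
Qed.

Lemma homogenization_homog : all (fun m => size m.2 == d) homogenization.
Proof.
rewrite !all_cat !all_map; apply/and3P; split.
- by apply: sub_all sQ => m /= /eqP sm; rewrite size_cat size_nseq size_map sm subnK // ltnW.
- by apply: sub_all sC => m /= /eqP sm; rewrite size_cat size_nseq size_map sm subnK.
by apply/allP => i _ /=; rewrite size_cat size_nseq /= addn1 prednK // (ltn_trans _ d_ge3).
Qed.

Lemma pkeller_homogenization : pkeller (Q ++ C) -> pkeller homogenization.
Proof.
move=> kL [[x y] s] [[h k] l] E.
have El : l = 0.
  by move/(congr1 snd): (E); rewrite /= DEv_homogenization_t addr0.
move: E; rewrite {}El DEv_homogenization => - [/= E1 E2 _].
have Ek : k = - (s ^+ (d - 3) *: DEv C x h) by apply/eqP; rewrite -addr_eq0 E2.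
suff h0 : h = 0 by rewrite Ek h0 linear0 scaler0 oppr0.
(* At this point [DQ] gains the factor [s^(d-2)] and [DC] the factor [s^(2(d-2)) = s^(d-1) s^(d-3)].
   Nothing is divided by [s], so [s = 0] is covered. *)
apply: (kL (s ^+ (d - 2) *: x)); rewrite DEv_cat (DEvZ _ _ _ sQ) (DEvZ _ _ _ sC) -[RHS]E1.
congr (_ + (_ + _)).
rewrite Ek scalerN opprK scalerA -exprM -exprD; congr (_ ^+ _ *: _).
by rewrite /=; lia.
Qed.

Lemma rinv_homogenization : rinv homogenization -> rinv (Q ++ C).
Proof.
(* The last component is preserved, hence stays [1], and the zero in the middle forces
   [y = -C(x)]. *)
case=> G PG EG; pose i (v : V) : W := (v, 0, 1).
exists (fun u => px (G (i u))).
  apply: (polymap_comp (polymap_hom px)); apply: (polymap_comp PG).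
  apply: polymap_ext (polymapD (polymap_hom (linfun i1)) (polymap_cst V (0, 0, 1 : K^o))) => u.
  by rewrite lfunE /i /= /inl_vect; congr (_, _, _); rewrite /= ?addr0 ?add0r.
move=> u; have := EG (i u); rewrite pxE; case: (G (i u)) => [[x y] s] /=.
rewrite Ev_homogenization => - [/= E1 E2]; rewrite addr0 => E3.
move: E1 E2; rewrite E3 !expr1n !scale1r => E1 E2.
have Ey : y = - Ev C x by apply/eqP; rewrite -addr_eq0 E2.
by rewrite Ev_cat -E1 Ey opprK.
Qed.

End Homogenize.

Lemma reduce_to_homogeneous (K : numClosedFieldType) d : (3 <= d)%N ->
  (forall (V : vectType K) (L : seq (V * seq (dual V))),
     all (fun m => size m.2 == d) L -> pkeller L -> rinv L) ->
  forall (V : vectType K) (L : seq (V * seq (dual V))),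
     all (fun m => 1 < size m.2)%N L -> pkeller L -> rinv L.
Proof.
move=> d3 H; apply: reduce_to_cubic => V L sL kL.
pose Q := [seq m <- L | size m.2 == 2]; pose C := [seq m <- L | size m.2 != 2].
have pe : perm_eq (Q ++ C) L by rewrite perm_filterC.
have sQ : all (fun m => size m.2 == 2) Q by rewrite filter_all.
have sC : all (fun m => size m.2 == 3) C.
  apply/allP => m; rewrite mem_filter => /andP[s2 /(allP sL)].
  by case: (size m.2) s2 => [|[|[|[|]]]].
suff [G PG EG] : rinv (Q ++ C) by exists G => // u; rewrite -(Ev_perm _ pe).
apply: (rinv_homogenization (d := d)); apply: H; first exact: homogenization_homog.
by apply: pkeller_homogenization => // x h; rewrite (DEv_perm _ _ pe); apply: kL.
Qed.

(** * Ryser's formula and reduction to power-linear maps *)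

Lemma poly_vanish (K : numClosedFieldType) (P : {poly K}) : (forall t, P.[t] = 0) -> P = 0.
Proof.
move=> H; apply/eqP/negPn/negP => P0.
have := @max_poly_roots _ P [seq i%:R | i <- iota 0 (size P)] P0.
rewrite size_map size_iota ltnn map_inj_uniq ?iota_uniq => [F|i j /eqP]; last first.
  by rewrite Num.Theory.eqr_nat => /eqP.
suff : false by []; apply: F => //.
by apply/allP => _ /mapP[i _ ->]; apply/rootP; apply: H.
Qed.

(** * The derivative depends only on the map *)

Section DerivativeUnique.
Variables (K : numClosedFieldType) (V W : vectType K).
Implicit Type L : seq (W * seq (dual V)).

Let line (s : seq (dual V)) x h : {poly K} := \prod_(l <- s) ((l x : K)%:P + (l h : K) *: 'X).

Let line_eval s x h t : (line s x h).[t] = mev s (x + t *: h).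
Proof.
rewrite /line /mev horner_prod; apply: eq_bigr => l _.
by rewrite dualD dualZ !hornerE mulrC.
Qed.

Let line_deriv s x h : (line s x h)^`().[0] = dmev s x h.
Proof.
elim: s => [|l s IH] /=; first by rewrite /line big_nil derivC hornerC.
rewrite /line big_cons derivM hornerD !hornerM -/(line s x h) IH line_eval.
by rewrite derivD derivC derivZ derivX !hornerE !(scale0r, mulr0, addr0, mulr1).
Qed.

(** Restricted to the line [x + t h] and read through a linear form, both maps become univariate
    polynomials in [t] with the same values, hence equal, and the derivatives are their linear
    coefficients. This carries [pkeller] from one list of monomials to another list of the same
    map. *)
Lemma DEv_unique L1 L2 : Ev L1 =1 Ev L2 -> forall x h, DEv L1 x h = DEv L2 x h.
Proof.
move=> E x h; apply: hom_sep => l.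
pose P L := \sum_(m <- L) (l m.1 : K) *: line m.2 x h.
have PE L t : (P L).[t] = l (Ev L (x + t *: h)).
  rewrite /P /Ev horner_sum linear_sum; apply: eq_bigr => m _.
  by rewrite hornerZ line_eval /= dualZ mulrC.
have PD L : (P L)^`().[0] = l (DEv L x h).
  rewrite /P /DEv [LHS](congr1 (horner^~ 0) (raddf_sum (@deriv K) _ _ _)).
  rewrite horner_sum linear_sum; apply: eq_bigr => m _.
  by rewrite /= derivZ hornerZ line_deriv /= dualZ mulrC.
rewrite -!PD; congr (_^`().[0]); apply/eqP; rewrite -subr_eq0; apply/eqP.
by apply: poly_vanish => t; rewrite hornerD hornerN !PE E subrr.
Qed.

End DerivativeUnique.

Section Ryser.
Variables (K : numClosedFieldType) (m : nat).

(** If [T] misses an index [i], toggling [i] in [S] is a sign-reversing involution on the supersets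
    of [T], so the sum equals its own opposite. *)
Lemma alternating_superset (T : {set 'I_m}) :
  \sum_(S : {set 'I_m} | T \subset S) (-1) ^+ #|~: S| = (T == setT)%:R :> K.
Proof.
have [->|] := eqVneq T setT.
  rewrite (big_pred1 setT) => [|S]; last by rewrite subTset.
  by rewrite setCT cards0.
rewrite -subTset => /subsetPn[i _ iT].
pose tog (S : {set 'I_m}) := if i \in S then S :\ i else i |: S.
have togI : involutive tog.
  move=> S; rewrite /tog; have [iS|iS] := boolP (i \in S).
    by rewrite setD11 setD1K.
  by rewrite setU11 setU1K.
apply/eqP; rewrite -Num.Theory.eqNr; apply/eqP.
rewrite [RHS](reindex_inj (inv_inj togI)) -sumrN; apply: eq_big => [S|S _].
  rewrite /tog; case: ifP => iS; first by rewrite subsetD1 iT andbT.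
  apply/idP/idP => [/subset_trans->|/subsetP H]; rewrite ?subsetUr //.
  apply/subsetP => x xT; have /setU1P[xi|//] := H _ xT.
  by rewrite -xi xT in iT.
rewrite /tog; case: ifP => iS.
  have -> : ~: (S :\ i) = i |: ~: S by apply/setP => x; rewrite !inE negb_and negbK.
  by rewrite cardsU1 inE iS /= exprS mulN1r.
have -> : #|~: S| = #|~: (i |: S)|.+1.
  rewrite (cardsD1 i) inE iS add1n; congr (#|pred_of_set _|.+1).
  by apply/setP => x; rewrite !inE negb_or.
by rewrite exprS mulN1r opprK.
Qed.

(** Inclusion-exclusion for the permanent: the products are expanded over all functions [f], and the
    alternating sum over sets containing the image of [f] keeps only the surjective ones, which are
    the permutations. *)
Lemma ryser (a : 'I_m -> 'I_m -> K) :
  \sum_(S : {set 'I_m}) (-1) ^+ #|~: S| * \prod_j \sum_(i in S) a i j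
  = \sum_(s : 'S_m) \prod_j a (s j) j.
Proof.
pose F := {ffun 'I_m -> 'I_m}.
transitivity (\sum_(f : F) \sum_(S : {set 'I_m} | f @: setT \subset S)
                (-1) ^+ #|~: S| * \prod_j a (f j) j).
  rewrite (exchange_big_dep predT) //=; apply: eq_bigr => S _.
  rewrite (bigA_distr_big _ (fun j i => a i j)) big_distrr /=; apply: eq_bigl => f.
  apply/ffun_onP/subsetP => [H x /imsetP[j _ ->]|H j]; first exact: H.
  by apply: H; rewrite imset_f.
under eq_bigr => f _ do rewrite -big_distrl alternating_superset /=.
rewrite (bigID (fun f : F => injectiveb f)) /= addrC big1 ?add0r => [|f Uf]; last first.
  case: eqP => [E|]; last by rewrite mul0r.
  case/negP: Uf; apply/injectiveP => i j Eij; apply: (imset_injP _ i j _ _ Eij) => //.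
  by rewrite E cardsT.
rewrite (reindex (@pval _)) /=; last first.
  pose in_Sn := insubd (1%g : 'S_m).
  by exists in_Sn => /= f Uf; first apply: val_inj; apply: insubdK.
apply: eq_big => /= [s | s _]; rewrite ?(valP s) //.
have -> : [set pval s x | x in setT] = setT.
  by apply/eqP; rewrite eqEcard subsetT pvalE card_imset ?leqnn //; apply: perm_inj.
by rewrite eqxx mul1r pvalE.
Qed.

End Ryser.

(** * Monomials as sums of powers of linear forms *)

Section Waring.
Variables (K : numClosedFieldType) (V W : vectType K).

Definition power_monomials d (P : seq (W * dual V)) : seq (W * seq (dual V)) :=
  [seq (m.1, nseq d m.2) | m <- P].

Lemma Ev_power d P x : Ev (power_monomials d P) x = \sum_(m <- P) (m.2 x : K) ^+ d *: m.1.
Proof. by rewrite /Ev big_map; apply: eq_bigr => m _; rewrite mev_nseq. Qed.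

Definition waring_monomial (m : W * seq (dual V)) : seq (W * dual V) :=
  let d := size m.2 in
  [seq ((d`!%:R^-1 * (-1) ^+ #|~: A|) *: m.1, \sum_(i in A) m.2`_i) | A : {set 'I_d}].

(** This is Ryser's formula for the matrix whose columns all equal the values of the forms at [x]:
    the column products become [d]-th powers and the permanent is [d!] times the monomial. *)
Lemma waring_monomialE m x :
  \sum_(q <- waring_monomial m) (q.2 x : K) ^+ size m.2 *: q.1 = mev m.2 x *: m.1.
Proof.
rewrite big_image /=; under eq_bigr do rewrite scalerA.
rewrite -scaler_suml; congr (_ *: _); set d := size m.2.
under eq_bigr do rewrite mulrC -mulrA; rewrite -big_distrr /=.
have -> : \sum_(S : {set 'I_d}) (-1) ^+ #|~: S| * ((\sum_(i in S) m.2`_i) x : K) ^+ d =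
          d`!%:R * mev m.2 x.
  transitivity (\sum_(s : 'S_d) \prod_(j < d) (m.2`_(s j) x : K)).
    rewrite -(ryser (fun i _ => (m.2`_i x : K))); apply: eq_bigr => S _.
    by rewrite sum_lfunE prodr_const card_ord.
  rewrite (eq_bigr (fun=> mev m.2 x)) => [|s _].
    by rewrite sumr_const card_Sn mulr_natl.
  rewrite /mev (big_nth 0) big_mkord -/d.
  by rewrite [RHS](reindex_perm s).
by rewrite mulKf // Num.Theory.pnatr_eq0 -lt0n fact_gt0.
Qed.

Lemma waring d (L : seq (W * seq (dual V))) : all (fun m => size m.2 == d) L ->
  exists P, forall x, Ev (power_monomials d P) x = Ev L x.
Proof.
move=> sL; exists (flatten (map waring_monomial L)) => x.
rewrite Ev_power big_flatten big_map /Ev big_seq [RHS]big_seq; apply: eq_bigr => m mL.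
by rewrite -waring_monomialE; have /eqP-> := allP sL m mL.
Qed.
End Waring.

Lemma reduce_to_powers (K : numClosedFieldType) d : (3 <= d)%N ->
  (forall (V : vectType K) (P : seq (V * dual V)),
     pkeller (power_monomials d P) -> rinv (power_monomials d P)) ->
  forall (V : vectType K) (L : seq (V * seq (dual V))),
     all (fun m => 1 < size m.2)%N L -> pkeller L -> rinv L.
Proof.
move=> d3 H; apply: (reduce_to_homogeneous d3) => V L sL kL.
have [P EP] := waring sL.
suff [G PG EG] : rinv (power_monomials d P) by exists G => // u; rewrite -EP.
by apply: H => x h; rewrite (DEv_unique EP); apply: kL.
Qed.

(** * Nilpotency of the derivative *)

(** The characteristic polynomial splits and all its roots vanish, so it is a power of [X];
    Cayley-Hamilton concludes. *)
Lemma mx_nilpotent (K : numClosedFieldType) n (M : 'M[K]_n) :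
  (forall a (v : 'rV_n), a != 0 -> v *m M = a *: v -> v = 0) ->
  forall v : 'rV_n, iter n (mulmxr M) v = 0.
Proof.
case: n M => [|n] M H v; first by rewrite thinmx0.
have [rs] := closed_field_poly_normal (char_poly M).
rewrite (monicP (char_poly_monic M)) scale1r => E.
have rs0 r : r \in rs -> r = 0.
  move=> rrs; apply/eqP/negPn/negP => r0.
  have /eigenvalueP[w /(H _ _ r0) -> /eqP//] : eigenvalue M r.
  by rewrite eigenvalue_root_char E root_prod_XsubC.
have {}E : char_poly M = 'X ^+ n.+1.
  have := size_char_poly M; rewrite E size_prod_XsubC => - [<-].
  rewrite big_seq (eq_bigr (fun=> 'X)) => [|r /rs0 ->]; last by rewrite subr0.
  by rewrite -big_seq big_const_seq count_predT iter_mulr_1.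
have MN : M ^+ n.+1 = 0.
  by have := Cayley_Hamilton M; rewrite E rmorphXn /= horner_mx_X.
have it k : iter k (mulmxr M) v = v *m M ^+ k.
  by elim: k => [|k IH]; rewrite ?expr0 ?mulmx1 // iterS IH exprSr /= -mulmxA.
by rewrite it MN mulmx0.
Qed.

Section LinNilpotent.
Import VectorInternalTheory.

Lemma lin_nilpotent (K : numClosedFieldType) (V : vectType K) (f : {linear V -> V}) :
  (forall a v, a != 0 -> f v = a *: v -> v = 0) ->
  forall v, iter (\dim {:V}) f v = 0.
Proof.
move=> H v; rewrite dimvf; pose M := lin1_mx (v2r \o f \o r2v).
have ME u : u *m M = v2r (f (r2v u)) by rewrite mul_rV_lin1.
have it k w : v2r (iter k f w) = iter k (mulmxr M) (v2r w).
  by elim: k => //= k IH; rewrite -IH ME v2rK.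
apply: (can_inj v2rK); rewrite linear0 it; apply: mx_nilpotent => a w a0 Ew.
apply: (can_inj r2vK); rewrite linear0; apply: H a0 _.
by apply: (can_inj v2rK); rewrite -ME Ew linearZ /= r2vK.
Qed.

End LinNilpotent.

Lemma DEv_nilpotent (K : numClosedFieldType) (V : vectType K) d (L : seq (V * seq (dual V))) :
  (1 < d)%N -> all (fun m => size m.2 == d) L -> pkeller L ->
  forall x h, iter (\dim {:V}) (DEv L x) h = 0.
Proof.
move=> d1 sL kL x; apply: lin_nilpotent => a h a0 /= Eh.
(* Scaling the point by [s] multiplies the derivative by [s^(d-1) = - a^-1], so an eigenvector for
   [a] satisfies the equation that [pkeller] excludes for nonzero vectors. *)
pose s := d.-1.-root (- a^-1).
have d0 : (0 < d.-1)%N by rewrite -ltnS prednK // ltnW.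
apply: (kL (s *: x)); rewrite (DEvZ _ _ _ sL) rootCK // Eh.
by rewrite scalerA mulNr mulVf // scaleN1r subrr.
Qed.

(** * Compositions of multilinear maps along a path *)

Lemma big_zip (K : comPzRingType) (T U : Type) (t0 : T) (u0 : U) (f : T -> U -> K) s1 s2 :
  size s1 = size s2 ->
  \prod_(q <- zip s1 s2) f q.1 q.2 = \prod_(j < size s2) f (nth t0 s1 j) (nth u0 s2 j).
Proof.
move=> E; rewrite (big_nth (t0, u0)) size_zip E minnn big_mkord.
by apply: eq_bigr => j _; rewrite nth_zip.
Qed.

Section PathForm.
Variables (K : numClosedFieldType) (V : vectType K) (c : nat) (P : seq (V * dual V)).

Definition Bform (xs : seq V) : V :=
  - \sum_(m <- P) (\prod_(x <- xs) (m.2 x : K)) *: m.1.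

Lemma Bform_perm xs ys : perm_eq xs ys -> Bform xs = Bform ys.
Proof. by move=> E; congr (- _); apply: eq_bigr => m _; rewrite (perm_big _ E). Qed.

Lemma Bform_is_linear xs : linear (fun x => Bform (x :: xs)).
Proof.
move=> a x y; rewrite /Bform scalerN scaler_sumr -opprD -big_split /=; congr (- _).
by apply: eq_bigr => m _; rewrite !big_cons dualD dualZ mulrDl scalerDl scalerA mulrA.
Qed.

(** The value at the top of a path of length [p] whose bottom vertex has value [z] and whose
    siblings have values [ws], [c] per level from the top. The path child comes first, which is
    harmless because [Bform] is symmetric. *)
Fixpoint pathform (p : nat) (z : V) (ws : seq V) : V :=
  if p is p'.+1 then Bform (pathform p' z (drop c ws) :: take c ws) else z.

(** Multilinearity made explicit: each term pairs one linear form with each sibling, so that Ryser's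
    formula can be applied term by term. *)
Lemma pathform_monomials p z : exists2 M : seq (V * seq (dual V)),
  forall m, m \in M -> size m.2 = (p * c)%N
  & forall ws, size ws = (p * c)%N ->
      pathform p z ws = \sum_(m <- M) (\prod_(q <- zip m.2 ws) (q.1 q.2 : K)) *: m.1.
Proof.
elim: p => [|p [M sM EM]].
  exists [:: (z, [::])] => [m|[|//] _]; first by rewrite inE => /eqP->.
  by rewrite big_seq1 big_nil scale1r.
pose cons_monomial (q : V * dual V) (m : V * seq (dual V)) :=
  (- (q.2 m.1 : K) *: q.1, nseq c q.2 ++ m.2).
exists (allpairs cons_monomial P M) => [m|ws sw].
  case/allpairsP=> [[q m'] [_ /sM /= sm' ->]].
  by rewrite size_cat size_nseq sm' mulSn.
have st : size (take c ws) = c by rewrite size_takel // sw mulSn leq_addr.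
have sd : size (drop c ws) = (p * c)%N by rewrite size_drop sw mulSn addKn.
rewrite /= EM // /Bform -sumrN big_allpairs_dep; apply: eq_bigr => q _.
rewrite big_cons -scaleNr linear_sum mulr_suml -sumrN scaler_suml.
rewrite big_seq [RHS]big_seq; apply: eq_bigr => m mM /=.
rewrite dualZ scalerA; congr (_ *: _).
rewrite -[in RHS](cat_take_drop c ws) zip_cat ?size_nseq // big_cat /=.
have -> : \prod_(i <- zip (nseq c q.2) (take c ws)) (i.1 i.2 : K) =
          \prod_(x <- take c ws) (q.2 x : K).
  rewrite -{1}st; elim: (take c ws) => [|x s IH]; rewrite ?big_nil //.
  by rewrite /= !big_cons IH.
by ring.
Qed.

Lemma pathform_const p x z :
  pathform p z (nseq (p * c) x) = iter p (fun h => Bform (h :: nseq c x)) z.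
Proof.
elim: p => //= p IH; rewrite mulSn nseqD drop_size_cat ?size_nseq //.
by rewrite take_size_cat ?size_nseq // IH.
Qed.

(* Ryser's formula as polarization: the sum over all orders of the arguments is a
   combination of values on constant argument lists. *)
Lemma pathform_shuffle_sum p z (w : 'I_(p * c) -> V) :
  (forall x, pathform p z (nseq (p * c) x) = 0) ->
  \sum_(s : 'S_(p * c)) pathform p z [seq w (s i) | i : 'I_(p * c)] = 0.
Proof.
move=> H; have [M sM EM] := pathform_monomials p z.
have Eimg (f : 'I_(p * c) -> V) : pathform p z [seq f i | i : 'I_(p * c)] =
    \sum_(m <- M) (\prod_(j < p * c) (m.2`_j (f j) : K)) *: m.1.
  rewrite EM ?size_image ?card_ord // big_seq [RHS]big_seq; apply: eq_bigr => m mM.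
  congr (_ *: _); rewrite (big_zip 0 0 (fun (l : dual V) x => (l x : K))); last first.
    by rewrite sM // size_image card_ord.
  rewrite size_image card_ord; apply: eq_bigr => j _; congr (_ _ _).
  by rewrite (nth_map j) ?size_enum_ord // nth_ord_enum.
under eq_bigr do rewrite Eimg.
rewrite exchange_big /=.
(* Each term is taken at the constant list of the partial sum of [w] over [A], where the hypothesis
   gives zero; term by term, the entries for Ryser's formula are the values of the [j]-th form at
   [w i]. *)
transitivity (\sum_(A : {set 'I_(p * c)})
    (-1) ^+ #|~: A| *: pathform p z [seq \sum_(j in A) w j | i : 'I_(p * c)]); last first.
  rewrite big1 // => A _; set v := \sum_(j in A) w j.
  have -> : [seq v | i : 'I_(p * c)] = nseq (p * c) v.
    by rewrite /image_mem -[in RHS](size_enum_ord (p * c)); elim: (enum _) => //= a s ->.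
  by rewrite H scaler0.
under [RHS]eq_bigr do rewrite Eimg scaler_sumr.
rewrite [RHS]exchange_big /=; apply: eq_bigr => m _.
rewrite -scaler_suml; under [RHS]eq_bigr do rewrite scalerA.
rewrite -scaler_suml; congr (_ *: _).
rewrite -(ryser (fun i j => (m.2`_j (w i) : K))); apply: eq_bigr => A _; congr (_ * _).
by apply: eq_bigr => j _; rewrite linear_sum.
Qed.

(** When all siblings equal [x], each level applies the derivative at [x] up to the factor
    [-1/(c+1)], as [l^(c+1)] has derivative [(c+1) l(x)^c l(h)]. *)
Lemma pathform_nilpotent n :
  c != 0 -> (forall x h, iter n (DEv (power_monomials c.+1 P) x) h = 0) ->
  forall z x, pathform n z (nseq (n * c) x) = 0.
Proof.
move=> c0 H z x; rewrite pathform_const.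
have E h : Bform (h :: nseq c x) = - c.+1%:R^-1 *: DEv (power_monomials c.+1 P) x h.
  rewrite /Bform /DEv big_map scaleNr scaler_sumr; congr (- _); apply: eq_bigr => m _.
  rewrite dmev_nseq scalerA mulKf ?pnatr_eq0 // big_cons big_nseq iter_mulr_1.
  by rewrite mulrC.
suff -> k : iter k (fun h => Bform (h :: nseq c x)) z =
    (- c.+1%:R^-1) ^+ k *: iter k (DEv (power_monomials c.+1 P) x) z by rewrite H scaler0.
elim: k => [|k IH]; first by rewrite scale1r.
by rewrite !iterS IH E linearZ scalerA exprS.
Qed.

End PathForm.

(** * Rearranging siblings along a path *)

Section TreePaths.
Implicit Types (t s : tree) (cs ws : seq tree) (a v ds : seq nat) (d j : nat).

Lemma replace_NodeE cs j a s : (j < size cs)%N ->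
  replace (Node cs) (j :: a) s =
  Node (take j cs ++ replace (nth Leaf cs j) a s :: drop j.+1 cs).
Proof. by move=> jcs; rewrite /= jcs set_nthE jcs. Qed.

(** If there is no vertex at [a], [replace] leaves the tree unchanged, so the default value does no
    harm. *)
Lemma replace_subtree t a : replace t a (odflt Leaf (subtree t a)) = t.
Proof.
elim: a t => [|j a IH] [|cs] //=; case: ifP => //= jcs.
by rewrite jcs IH set_nthE jcs -drop_nth // cat_take_drop.
Qed.

Lemma nth_splice cs j x : (j < size cs)%N ->
  nth Leaf (take j cs ++ x :: drop j.+1 cs) j = x.
Proof. by move=> jcs; rewrite nth_cat size_takel ?(ltnW jcs) // ltnn subnn. Qed.

Lemma size_splice cs j x : (j < size cs)%N ->
  size (take j cs ++ x :: drop j.+1 cs) = size cs.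
Proof.
by move=> jcs; rewrite size_cat size_takel ?(ltnW jcs) //= size_drop; lia.
Qed.

Lemma splice_splice cs j x y : (j < size cs)%N ->
  let cs' := take j cs ++ x :: drop j.+1 cs in
  take j cs' ++ y :: drop j.+1 cs' = take j cs ++ y :: drop j.+1 cs.
Proof.
move=> jcs /=; have sj : size (take j cs) = j by rewrite size_takel // ltnW.
rewrite take_size_cat //; congr (_ ++ _ :: _).
by rewrite -cat_rcons drop_size_cat // size_rcons sj.
Qed.

Lemma subtree_replace t a s : subtree t a != None -> subtree (replace t a s) a = Some s.
Proof.
elim: a t => [|j a IH] [|cs] //=; case: ifP => // jcs /IH E.
by rewrite set_nthE jcs /= size_splice // jcs nth_splice.
Qed.

Lemma replace_replace t a s s' : replace (replace t a s) a s' = replace t a s'.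
Proof.
elim: a t => [|j a IH] [|cs] //=; case: ifP => jcs /=; rewrite ?jcs //.
rewrite !set_nthE jcs size_splice // jcs nth_splice // IH.
by rewrite (splice_splice _ _ jcs).
Qed.

Lemma replace_cat t a v s t' : subtree t a = Some t' ->
  replace t (a ++ v) s = replace t a (replace t' v s).
Proof.
elim: a t => [|j a IH] [|cs] //=; try by case=> <-.
by case: ifP => // jcs /IH ->.
Qed.

Lemma subtree_cat t a v : subtree t (a ++ v) = obind (fun t' => subtree t' v) (subtree t a).
Proof. by elim: a t => [|j a IH] [|cs] //=; case: ifP. Qed.

Definition replace_all t (rs : seq (seq nat * tree)) : tree :=
  foldl (fun acc q => replace acc q.1 q.2) t rs.

Lemma replace_all_prefix t a t' Q ws : subtree t a = Some t' ->
  replace_all t (zip (map (cat a) Q) ws) = replace t a (replace_all t' (zip Q ws)).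
Proof.
elim: Q ws t t' => [|q Q IH] [|w ws] t t' E; rewrite /replace_all /=;
  try by rewrite -[in LHS](replace_subtree t a) E.
rewrite (replace_cat _ _ E) -/(replace_all _ _) (IH _ _ (replace t' q w)).
  by rewrite replace_replace.
by rewrite subtree_replace // E.
Qed.

Lemma replace_all_children cs i n ws :
  size ws = n -> (i + n <= size cs)%N ->
  replace_all (Node cs) (zip [seq [:: j] | j <- iota i n] ws) =
  Node (take i cs ++ ws ++ drop (i + n) cs).
Proof.
move=> <-{n}; elim: ws i cs => [|w ws IH] i cs /= le; rewrite /replace_all /=.
  by rewrite addn0 cat_take_drop.
have ics : (i < size cs)%N by lia.
rewrite ics set_nthE ics -/(replace_all _ _) IH ?size_splice //; last by lia.
have si : size (take i cs) = i by rewrite size_takel // ltnW.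
rewrite -cat_rcons take_size_cat ?size_rcons ?si // drop_cat size_rcons si.
rewrite ltnNge leq_addr /= addKn drop_drop cat_rcons.
by congr (Node (_ ++ _ :: _ ++ drop _ _)); lia.
Qed.

Lemma sib_positions_prefix d v ds :
  sib_positions d v ds = map (cat v) (sib_positions d [::] ds).
Proof.
rewrite /sib_positions map_flatten -map_comp; congr flatten; apply: eq_map => i.
by rewrite /= -map_comp.
Qed.

Lemma sib_positions_cons d c ds :
  sib_positions d [::] (c :: ds) =
  [seq [:: j] | j <- [seq j <- iota 0 d | j != c]] ++ map (cat [:: c]) (sib_positions d [::] ds).
Proof.
rewrite /sib_positions /=; congr cat; rewrite map_flatten -map_comp (iotaDl 1 0) -map_comp.
by congr flatten; apply: eq_map => i /=; rewrite -map_comp.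
Qed.

Lemma iota_neq d c : (c < d)%N ->
  [seq j <- iota 0 d | j != c] = iota 0 c ++ iota c.+1 (d - c.+1).
Proof.
move=> cd; rewrite -{1}(subnKC (ltnW cd)) iotaD filter_cat add0n.
rewrite (_ : (d - c)%N = (d - c.+1).+1); last by lia.
rewrite /= eqxx /=; congr cat; apply/all_filterP/allP => j; rewrite mem_iota; lia.
Qed.

(* [ws] lists the new siblings level by level from the top, and from left to right on each
   level, in the order of [sib_positions]. *)
Fixpoint fill d t ds ws : tree :=
  if (ds, t) is (c :: ds', Node cs) then
    Node (take c (take d.-1 ws) ++ fill d (nth Leaf cs c) ds' (drop d.-1 ws)
            :: drop c (take d.-1 ws))
  else t.

Lemma size_sib_positions d t ds : is_dcat d t -> subtree t ds != None ->
  size (sib_positions d [::] ds) = (size ds * d.-1)%N.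
Proof.
elim: ds t => [|c ds IH] [|cs] //= /andP[/eqP sd dcs]; case: ifP => // ccs sub.
rewrite sib_positions_cons size_cat !size_map (IH _ _ sub); last exact/(allP dcs)/mem_nth.
by rewrite sd in ccs; rewrite iota_neq // size_cat !size_iota mulSn; lia.
Qed.

(** The replacements on the top level form two blocks, left and right of the path child [c], and do
    not touch it; all later ones take place inside that child. *)
Lemma replace_all_fill d t ds ws : is_dcat d t -> subtree t ds != None ->
  size ws = (size ds * d.-1)%N ->
  replace_all t (zip (sib_positions d [::] ds) ws) = fill d t ds ws.
Proof.
elim: ds t ws => [|c ds IH] [|cs] ws //=; try by move=> _ _ /size0nil ->.
move=> /andP[/eqP sd dcs]; case: ifP => // ccs sub sw.
have dc : is_dcat d (nth Leaf cs c) by exact/(allP dcs)/mem_nth.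
have cd : (c < d)%N by rewrite -sd.
rewrite mulSn in sw; set w := take d.-1 ws.
have sww : size w = d.-1 by rewrite size_takel // sw leq_addr.
have s1 : size (take c w) = c by rewrite size_takel // sww; lia.
have s2 : size (drop c w) = (d - c.+1)%N by rewrite size_drop sww; lia.
have -> : ws = (take c w ++ drop c w) ++ drop d.-1 ws by rewrite !cat_take_drop.
rewrite sib_positions_cons iota_neq // map_cat.
rewrite !zip_cat ?size_cat ?size_map ?size_iota ?s1 ?s2 //.
rewrite /replace_all !foldl_cat -!/(replace_all _ _).
rewrite replace_all_children // ?add0n ?take0 ?cat0s ?(ltnW ccs) //.
set cs1 := take c w ++ drop c cs.
have ss1 : size cs1 = size cs by rewrite size_cat s1 size_drop; lia.
rewrite replace_all_children ?ss1 //; last by rewrite sd; lia.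
have -> : drop (c.+1 + (d - c.+1)) cs1 = [::] by rewrite drop_oversize // ss1 sd; lia.
rewrite cats0.
have -> : take c.+1 cs1 = rcons (take c w) (nth Leaf cs c).
  by rewrite /cs1 (drop_nth Leaf ccs) -cat_rcons take_size_cat // size_rcons s1.
rewrite cat_rcons; set x := nth Leaf cs c.
rewrite (@replace_all_prefix _ _ x); last first.
  rewrite /= size_cat /= s1 s2 (_ : (c < _)%N); last by lia.
  by rewrite nth_cat s1 ltnn subnn.
rewrite IH //; last by rewrite size_drop sw addKn.
rewrite replace_NodeE /=; last by rewrite size_cat s1 /= -addSnnS leq_addr.
rewrite take_size_cat //; congr (Node (_ ++ _ :: _)); first by rewrite !cat_take_drop.
by rewrite -cat_rcons drop_size_cat // size_rcons s1.
Qed.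

(** The moved subtrees are read from the original tree and not from the accumulator, so they can be
    listed before any replacement is made. *)
Lemma rearrangeE t Q f :
  rearrange t Q f =
  replace_all t (zip Q [seq odflt Leaf (subtree t (nth [::] Q (f q))) | q <- iota 0 (size Q)]).
Proof.
rewrite -[X in zip X _](mkseq_nth [::] Q) /mkseq zip_map /rearrange /replace_all.
(* The tree read from is separated from the accumulator, so that the induction varies only the
   latter. *)
move: {1 4}t (nth [::] Q) (iota _ _) => t' h qs; elim: qs t => //= q qs IH t.
Qed.

(** Two permutations therefore give the same tree only if they put equal subtrees in each position,
    which makes the permutations giving one tree countable. *)
Lemma fill_inj d t ds ws ws' : is_dcat d t -> subtree t ds != None ->
  size ws = (size ds * d.-1)%N -> size ws' = (size ds * d.-1)%N ->
  fill d t ds ws = fill d t ds ws' -> ws = ws'.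
Proof.
elim: ds t ws ws' => [|c ds IH] [|cs] ws ws' //=.
- by move=> _ _ /size0nil -> /size0nil ->.
- by move=> _ _ /size0nil -> /size0nil ->.
move=> /andP[/eqP sd dcs]; case: ifP => // ccs sub; rewrite mulSn => sw sw' [].
have st : size (take d.-1 ws) = d.-1 by rewrite size_takel // sw leq_addr.
have st' : size (take d.-1 ws') = d.-1 by rewrite size_takel // sw' leq_addr.
move/eqP; rewrite eqseq_cat; last by rewrite !(size_take_min c) st st'.
rewrite eqseq_cons => /and3P[/eqP E1 /eqP E2 /eqP E3].
rewrite -(cat_take_drop d.-1 ws) -(cat_take_drop d.-1 ws').
congr cat; first by rewrite -(cat_take_drop c (take _ ws)) E1 E3 cat_take_drop.
apply: IH E2 => //; first exact/(allP dcs)/mem_nth.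
  by rewrite size_drop sw addKn.
by rewrite size_drop sw' addKn.
Qed.

Lemma is_dcat_fill d t ds ws : is_dcat d t -> subtree t ds != None ->
  size ws = (size ds * d.-1)%N -> all (is_dcat d) ws -> is_dcat d (fill d t ds ws).
Proof.
elim: ds t ws => [|c ds IH] [|cs] ws //= /andP[/eqP sd dcs].
case: ifP => // ccs sub; rewrite mulSn => sw dws.
have st : size (take d.-1 ws) = d.-1 by rewrite size_takel // sw leq_addr.
move: dws; rewrite -(cat_take_drop d.-1 ws) all_cat => /andP[dw1 dw2].
rewrite cat_take_drop size_cat /= addnS -size_cat cat_take_drop st prednK; last by lia.
rewrite eqxx /= all_cat /= andbCA -all_cat cat_take_drop dw1 andbT.
apply: IH => //; first exact/(allP dcs)/mem_nth.
by rewrite size_drop sw addKn.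
Qed.

Lemma internal_fill d t ds : is_dcat d t -> subtree t ds != None ->
  exists n, forall ws, size ws = (size ds * d.-1)%N ->
    internal (fill d t ds ws) = (n + sumn (map internal ws))%N.
Proof.
elim: ds t => [|c ds IH] t /=.
  by exists (internal t) => ws /size0nil ->; rewrite addn0; case: t {H}.
case: t => [|cs] //= /andP[/eqP sd dcs]; case: ifP => // ccs sub.
have [|n En] := IH _ _ sub; first exact/(allP dcs)/mem_nth.
exists n.+1 => ws; rewrite mulSn => sw.
rewrite map_cat sumn_cat /= En; last by rewrite size_drop sw addKn.
rewrite -[in RHS](cat_take_drop d.-1 ws) map_cat sumn_cat.
rewrite -[X in (_ = _ + (sumn (map _ X) + _))%N](cat_take_drop c) map_cat sumn_cat; lia.
Qed.

Lemma is_dcat_replace d t a s :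
  is_dcat d t -> is_dcat d s -> is_dcat d (replace t a s).
Proof.
elim: a t => [|j a IH] [|cs] //= /andP[/eqP sd dcs] dS; case: ifP => jcs /=; last first.
  by rewrite sd eqxx.
rewrite set_nthE jcs size_splice // sd eqxx /= all_cat /= IH //; last exact/(allP dcs)/mem_nth.
by move: dcs; rewrite -{1}(cat_take_drop j cs) (drop_nth Leaf jcs) all_cat /= => /and3P[-> _ ->].
Qed.

Lemma is_dcat_subtree d t a s : is_dcat d t -> subtree t a = Some s -> is_dcat d s.
Proof.
elim: a t => [|j a IH] [|cs] //=; try by move=> ? [<-].
by move=> /andP[_ dcs]; case: ifP => // jcs; apply: IH; exact/(allP dcs)/mem_nth.
Qed.

Lemma internal_replace t a : subtree t a != None ->
  exists n, forall s, internal (replace t a s) = (n + internal s)%N.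
Proof.
elim: a t => [|j a IH] [|cs] //=; try by exists 0%N.
case: ifP => // jcs /IH[n En].
exists (sumn (map internal (take j cs)) + sumn (map internal (drop j.+1 cs)) + n).+1 => s.
by rewrite set_nthE jcs /= map_cat sumn_cat /= En; lia.
Qed.

End TreePaths.

(** * Trees as formal compositions *)

Section TreeEval.
Variables (K : numClosedFieldType) (V : vectType K) (c : nat) (P : seq (V * dual V)) (u : V).
Notation d := c.+1.

Fixpoint ev (t : tree) : V := if t is Node cs then Bform P (map ev cs) else u.

Definition Bform_head xs x := Bform P (x :: xs).
HB.instance Definition _ xs :=
  GRing.isLinear.Build K V V _ (Bform_head xs) (Bform_is_linear P xs).

(** Every ancestor applies a multilinear form, and symmetry lets the modified child be its first
    argument. *)
Lemma ev_replace t a : subtree t a != None ->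
  exists f : {linear V -> V}, forall s, ev (replace t a s) = f (ev s).
Proof.
elim: a t => [|j a IH] [|cs] //=; try by exists idfun.
case: ifP => // jcs /IH[f Ef].
pose xs := map ev (take j cs ++ drop j.+1 cs).
exists (Bform_head xs \o f) => s /=.
rewrite set_nthE jcs /= -Ef; apply: Bform_perm.
by rewrite -map_cons; apply: perm_map; rewrite perm_catC /= perm_cons perm_catC.
Qed.

(** The vector [z] is the value of the bottom vertex; by symmetry of [Bform] the child indices along
    the path do not affect the value. *)
Lemma ev_fill t ds : is_dcat d t -> subtree t ds != None ->
  exists z, forall ws, size ws = (size ds * c)%N ->
    ev (fill d t ds ws) = pathform c P (size ds) z (map ev ws).
Proof.
elim: ds t => [|j ds IH] t; first by move=> _ _; exists (ev t); case: t.
case: t => [|cs] //= /andP[/eqP sd dcs]; case: ifP => // jcs sub.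
have [|z Ez] := IH _ _ sub; first exact/(allP dcs)/mem_nth.
exists z => ws; rewrite mulSn => sw.
rewrite -map_drop -map_take -Ez; last by rewrite size_drop sw addKn.
rewrite -map_cons; apply/Bform_perm/perm_map.
rewrite perm_catC /= perm_cons perm_catC.
by rewrite cat_take_drop.
Qed.

End TreeEval.

Lemma image_insub (T : Type) (g : nat -> T) m (s : 'S_m) :
  [seq g (oapp (fun i : 'I_m => val (s i)) q (insub q)) | q <- iota 0 m] =
  [seq g (s i) | i : 'I_m].
Proof.
by rewrite -val_enum_ord -map_comp; apply: eq_map => i /=; rewrite valK.
Qed.

Lemma image_ord_inj (T : Type) m (f g : 'I_m -> T) :
  [seq f i | i : 'I_m] = [seq g i | i : 'I_m] -> f =1 g.
Proof.
move=> E i; have := congr1 (nth (f i) ^~ i) E.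
rewrite (nth_map i _ f) ?size_enum_ord // (nth_map i _ g) ?size_enum_ord //.
by rewrite nth_ord_enum.
Qed.

Lemma sumn_image m (f : 'I_m -> nat) : sumn [seq f i | i : 'I_m] = (\sum_i f i)%N.
Proof. by rewrite sumnE big_image. Qed.

Lemma big_seq_eq (V : nmodType) (I : eqType) (r : seq I) i (F : I -> V) :
  uniq r -> i \in r -> \sum_(j <- r | i == j) F j = F i.
Proof.
move=> Ur ir; rewrite (big_rem i) //= eqxx big_seq_cond big1 ?addr0 // => j.
by rewrite mem_rem_uniq // !inE eq_sym => /andP[/andP[/negPf->]].
Qed.

(** The number of sibling positions equals [p * c] only by a proved equation; this form avoids casts
    between symmetric groups. *)
Lemma pathform_shuffle_sum_eq (K : numClosedFieldType) (V : vectType K) c P p (z : V) m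
    (E : m = (p * c)%N) (w : 'I_m -> V) :
  (forall x, pathform c P p z (nseq (p * c) x) = 0) ->
  \sum_(s : 'S_m) pathform c P p z [seq w (s i) | i : 'I_m] = 0.
Proof. by subst m; apply: pathform_shuffle_sum. Qed.

(** * The sum of tree values over a shuffle class *)

Section ShuffleClass.
Variables (c k : nat).
Notation d := c.+1.
Variables (T : tree) (v ds : seq nat).
Hypotheses (dT : dcat d k T) (vT : valid_path T v ds).

Let Q := sib_positions d v ds.
Let m := size Q.
Let sibs (q : nat) := odflt Leaf (subtree T (nth [::] Q q)).
Let shuffled (s : 'S_m) := rearrange T Q
  (fun q => oapp (fun i : 'I_(size Q) => val (s i)) q (insub q)).
Let order (s : 'S_m) := [seq sibs (s i) | i : 'I_m].

Let T0 := odflt Leaf (subtree T v).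

Let ET0 : subtree T v = Some T0.
Proof. by move: vT; rewrite /valid_path subtree_cat /T0; case: subtree. Qed.

Let vT0 : subtree T0 ds != None.
Proof. by move: vT; rewrite /valid_path subtree_cat ET0. Qed.

Let dT0 : is_dcat d T0.
Proof. by have /andP[dT' _] := dT; apply: is_dcat_subtree dT' ET0. Qed.

Lemma size_siblings : size (sib_positions d v ds) = (size ds * c)%N.
Proof. by rewrite sib_positions_prefix size_map (size_sib_positions dT0 vT0). Qed.

Let size_order s : size (order s) = (size ds * d.-1)%N.
Proof. by rewrite size_image card_ord /m /Q size_siblings. Qed.

Let shuffledE s : shuffled s = replace T v (fill d T0 ds (order s)).
Proof.
rewrite /shuffled rearrangeE (image_insub sibs s) -/(order s) {1}/Q sib_positions_prefix.
by rewrite (replace_all_prefix _ _ ET0) replace_all_fill.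
Qed.

Let shuffled_eq s s' : (shuffled s == shuffled s') = [forall i, sibs (s i) == sibs (s' i)].
Proof.
apply/eqP/forallP => [E i|H]; last first.
  by rewrite !shuffledE; congr (replace _ _ (fill _ _ _ _)); apply: eq_map => i; apply/eqP.
have /image_ord_inj/(_ i) -> // : order s = order s'.
apply: (fill_inj dT0 vT0 (size_order s) (size_order s')).
have := congr1 (subtree ^~ v) E; rewrite !shuffledE !subtree_replace ?ET0 //.
by case.
Qed.

Let shuffled1 : shuffled 1%g = T.
Proof.
rewrite /shuffled rearrangeE.
have -> : [seq odflt Leaf (subtree T (nth [::] Q
     (oapp (fun i : 'I_(size Q) => val ((1%g : 'S_m) i)) q (insub q)))) | q <- iota 0 (size Q)]
   = [seq odflt Leaf (subtree T q) | q <- Q].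
  rewrite -[in RHS](mkseq_nth [::] Q) /mkseq -map_comp; apply: eq_map => q /=.
  by case: insubP => //= i _ <-; rewrite perm1.
by elim: Q => //= q Q' IH; rewrite /replace_all /= replace_subtree.
Qed.

Let dcat_shuffled s : dcat d k (shuffled s).
Proof.
have /andP[dT' /eqP <-] := dT; apply/andP; split.
  rewrite shuffledE; apply: is_dcat_replace => //; apply: is_dcat_fill => //.
  apply/allP => _ /imageP[i _ ->]; rewrite /sibs; case E: subtree => [t|//] /=.
  exact: is_dcat_subtree dT' E.
have [n1 E1] := internal_fill dT0 vT0.
have [|n2 E2] := @internal_replace T v; first by rewrite ET0.
have Eo s' : sumn (map internal (order s')) = (\sum_(i < m) internal (sibs i))%N.
  by rewrite -map_comp (reindex_perm s') -sumn_image.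
(* [T] is its own shuffle by the identity, so both sides are the same constant plus the sum over all
   siblings. *)
by rewrite -[in X in _ == X]shuffled1 !shuffledE !E2 !E1 // !Eo.
Qed.

(** The class is a set of trees, while the vanishing sum runs over permutations. Each tree of the
    class comes from the same nonzero number [N] of permutations, so the two sums differ by the
    factor [N]. *)
Lemma shuffle_class_sum (K : numClosedFieldType) (V : vectType K) (P : seq (V * dual V))
    (u : V) (r : seq tree) :
  (forall z x, pathform c P (size ds) z (nseq (size ds * c) x) = 0) ->
  uniq r -> (forall t, (t \in r) = dcat d k t) ->
  \sum_(t <- r | shuffle_class d T v ds t) ev P u t = 0.
Proof.
move=> H Ur rE; set S := shuffle_class d T v ds.
have SE t : S t = [exists s, t == shuffled s] by [].
pose N := #|[set s | shuffled s == shuffled 1%g]|.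
(* Left multiplication by the inverse of [s0] carries the permutations giving the tree of [s0] to
   those giving the tree of the identity. *)
have NE s0 : #|[set s | shuffled s == shuffled s0]| = N.
  rewrite /N -[RHS](card_preimset _ (mulgI s0^-1%g)); apply: eq_card => s.
  rewrite !inE !shuffled_eq; apply/forallP/forallP => [F i|F i].
    by rewrite permM perm1 (eqP (F _)) permKV.
  by have := F (s0 i); rewrite permM perm1 permK.
have tot : \sum_(s : 'S_m) ev P u (shuffled s) = 0.
  have [z Ez] := ev_fill P u dT0 vT0.
  (* The part of the tree outside the subtree at [v] acts as one linear map [f], common to all
     shuffles. *)
  have [|f Ef] := @ev_replace K V P u T v; first by rewrite ET0.
  transitivity (f (\sum_(s : 'S_m) pathform c P (size ds) z [seq ev P u (sibs (s i)) | i : 'I_m])).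
    rewrite linear_sum; apply: eq_bigr => s _.
    by rewrite shuffledE Ef Ez // -map_comp.
  rewrite (_ : \sum_s _ = 0) ?linear0 //.
  have E : m = (size ds * c)%N by rewrite /m /Q size_siblings.
  exact: (pathform_shuffle_sum_eq E (fun i => ev P u (sibs i))).
suff : N%:R *: \sum_(t <- r | S t) ev P u t = 0.
  move/eqP; rewrite scaler_eq0 pnatr_eq0 => /orP[/eqP/cards0_eq N0|/eqP//].
  by have := in_set0 (1%g : 'S_m); rewrite -N0 inE eqxx.
rewrite -[RHS]tot.
transitivity (\sum_(s : 'S_m) \sum_(t <- r | shuffled s == t) ev P u t); last first.
  by apply: eq_bigr => s _; rewrite big_seq_eq // rE.
rewrite (exchange_big_dep predT) //= scaler_sumr big_mkcond /=; apply: eq_bigr => t _.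
rewrite sumr_const; case: ifP => St; last first.
  rewrite eq_card0 // => s; apply: contraFF St; rewrite SE => E.
  by apply/existsP; exists s; rewrite eq_sym.
move: St; rewrite SE => /existsP[s0 /eqP->].
by rewrite -(NE s0) scaler_nat; congr (_ *+ _); apply: eq_card => s; rewrite inE.
Qed.

End ShuffleClass.

(** * The formal inverse *)

Section Words.
Variable T : eqType.
Implicit Types (s w : seq T).

Fixpoint words n s : seq (seq T) :=
  if n is n'.+1 then [seq x :: w | x <- s, w <- words n' s] else [:: [::]].

Lemma mem_words n s w : (w \in words n s) = (size w == n) && all (mem s) w.
Proof.
elim: n w => [|n IH] [|x w] //=.
  by apply/allpairsP => - [[y w] [_ _]].
apply/allpairsP/idP => [[[y w'] /= [ys]]|/andP[sw /andP[xs ws]]].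
  by rewrite IH => /andP[sw ws] [-> ->]; rewrite eqSS sw ys.
by exists (x, w); split=> //=; rewrite IH ws andbT.
Qed.

Lemma uniq_words n s : uniq s -> uniq (words n s).
Proof.
move=> Us; elim: n => //= n IH.
by apply: allpairs_uniq => // - [x w] [y w'] _ _ [-> ->].
Qed.

Lemma sum_words (K : comNzRingType) n s (F : T -> K) :
  \sum_(w <- words n s) \prod_(x <- w) F x = (\sum_(x <- s) F x) ^+ n.
Proof.
elim: n => [|n IH] /=; first by rewrite big_seq1 big_nil.
rewrite big_allpairs_dep exprS mulr_suml; apply: eq_bigr => x _.
by rewrite -IH mulr_sumr; apply: eq_bigr => w _; rewrite big_cons.
Qed.
End Words.

Section TreeEnum.
Variable d : nat.

(** The trees are cut off by height, which suits recursion at the root; since the height is at most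
    the number of internal vertices, all trees with at most [h] internal vertices are present. *)
Fixpoint dtrees h : seq tree :=
  if h is h'.+1 then Leaf :: map Node (words d (dtrees h')) else [:: Leaf].

Lemma uniq_dtrees h : uniq (dtrees h).
Proof.
elim: h => //= h IH; rewrite map_inj_uniq ?uniq_words ?andbT //; last by move=> ? ? [].
by apply/negP => /mapP[].
Qed.

Lemma dtrees_dcat h t : t \in dtrees h -> is_dcat d t.
Proof.
elim: h t => [|h IH] t /=; first by rewrite inE => /eqP->.
rewrite inE => /predU1P[->//|/mapP[cs]]; rewrite mem_words => /andP[scs /allP acs ->] /=.
by rewrite scs; apply/allP => t' /acs /IH.
Qed.

Lemma mem_dtrees h t : is_dcat d t -> (internal t <= h)%N -> t \in dtrees h.
Proof.
elim: h t => [|h IH] [|cs] //=.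
move=> /andP[scs /allP acs]; rewrite ltnS => le.
rewrite inE; apply/orP; right; apply: map_f; rewrite mem_words scs /=.
apply/allP => t tcs; apply: IH; first exact: acs.
apply: leq_trans le; rewrite sumnE big_map (big_rem t) //=; exact: leq_addr.
Qed.

Lemma mem_dtrees_eq h k t : (k <= h)%N ->
  (t \in [seq t <- dtrees h | internal t == k]) = dcat d k t.
Proof.
move=> kh; rewrite mem_filter andbC; apply/andP/andP => [[/dtrees_dcat]|[dt /eqP it]] //.
by split; rewrite ?it // mem_dtrees // it.
Qed.
End TreeEnum.

Section FormalInverse.
Variables (K : numClosedFieldType) (V : vectType K) (d : nat) (P : seq (V * dual V)).

Lemma polymap_ev h t : t \in dtrees d h -> polymap (fun u => ev P u t).
Proof.
elim: h t => [|h IH] t /=.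
  by rewrite inE => /eqP-> l; apply: ispoly_lin.
rewrite inE => /predU1P[-> l|/mapP[cs]]; first exact: ispoly_lin.
rewrite mem_words => /andP[_ /allP acs] ->.
pose f u := \sum_(m <- P) - (\prod_(x <- map (ev P u) cs) (m.2 x : K)) *: m.1.
apply: (@polymap_ext _ _ _ f) => [u|].
  by rewrite /f /= /Bform -sumrN; under eq_bigr do rewrite scaleNr.
apply: polymap_sum => m; apply: polymapZ; last exact: polymap_cst.
have PM : ispoly (fun u => \prod_(x <- map (ev P u) cs) (m.2 x : K)).
  elim: cs acs {f} => [|t' cs IHc] acs.
    by apply: ispoly_ext (ispoly_const _ 1) => u; rewrite big_nil.
  have Pt : ispoly (fun u => m.2 (ev P u t') : K) by apply/IH/acs/mem_head.
  have Pcs : ispoly (fun u => \prod_(x <- map (ev P u) cs) (m.2 x : K)).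
    by apply: IHc => t'' t''cs; apply: acs; rewrite inE t''cs orbT.
  by apply: ispoly_ext (ispolyM Pt Pcs) => u /=; rewrite big_cons.
by apply: ispoly_ext (ispolyM (ispoly_const _ (-1)) PM) => u; rewrite mulN1r.
Qed.

Section GeneratingPolynomial.
Variables (u : V) (k0 : nat).

Let csum h k : V := \sum_(t <- dtrees d h | internal t == k) ev P u t.

Hypothesis csum0 : forall h k, (k0 <= k <= h)%N -> csum h k = 0.

Let csum_stable h h' k : (k <= h)%N -> (k <= h')%N -> csum h k = csum h' k.
Proof.
move=> kh kh'; rewrite /csum -big_filter -[RHS]big_filter; apply/perm_big/uniq_perm.
- by rewrite filter_uniq ?uniq_dtrees.
- by rewrite filter_uniq ?uniq_dtrees.
by move=> t; rewrite !mem_dtrees_eq.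
Qed.

(** The variable [X] marks internal vertices: up to degree [h] this is the formal inverse series,
    read through [l]. *)
Let gen (l : dual V) h : {poly K} :=
  \sum_(t <- dtrees d h) (l (ev P u t) : K) *: 'X^(internal t).

Let gen_trunc (l : dual V) : {poly K} :=
  \sum_(t <- dtrees d k0 | (internal t < k0)%N) (l (ev P u t) : K) *: 'X^(internal t).

Let Ginv := \sum_(t <- dtrees d k0 | (internal t < k0)%N) ev P u t.

Let coef_gen l h j : (gen l h)`_j = l (csum h j).
Proof.
rewrite /gen coef_sum linear_sum [RHS]big_mkcond /=; apply: eq_bigr => t _.
by rewrite coefZ coefXn eq_sym; case: eqP => _; rewrite ?mulr1 ?mulr0.
Qed.

Let coef_gen_trunc l j : (gen_trunc l)`_j = if (j < k0)%N then l (csum k0 j) else 0.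
Proof.
rewrite /gen_trunc coef_sum big_mkcond /=; case: ifP => jk; last first.
  rewrite big1 // => t _; case: ifP => // ik; rewrite coefZ coefXn eq_sym.
  by case: eqP => [E|_]; [rewrite -E ik in jk | rewrite mulr0].
rewrite linear_sum [RHS]big_mkcond /=; apply: eq_bigr => t _.
rewrite coefZ coefXn eq_sym; case: eqP => [->|_]; rewrite ?jk ?mulr1 ?mulr0 //.
by case: ifP.
Qed.

(** Below degree [k0] the coefficients do not depend on the height bound; from [k0] to [h] they
    vanish on both sides. *)
Let gen_truncP l h : (k0 <= h)%N -> dvdp 'X^(h.+1) (gen_trunc l - gen l h).
Proof.
move=> k0h; set p := _ - _; rewrite -(poly_take_drop h.+1 p).
suff -> : take_poly h.+1 p = 0 by rewrite add0r dvdp_mull.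
apply/polyP => j; rewrite coef_take_poly coef0; case: ifP => // jh.
rewrite coefB coef_gen coef_gen_trunc; case: ltnP => jk.
  by rewrite (@csum_stable h k0) ?subrr // ltnW.
by rewrite csum0 ?linear0 ?subrr // jk -ltnS.
Qed.

(** A tree is a leaf or a root with [d] subtrees of smaller height; the root contributes the factor
    [X] and the sign in [Bform]. *)
Let gen_rec l h : gen l h.+1 =
  (l u : K)%:P - 'X * \sum_(m <- P) (l m.1 : K) *: gen m.2 h ^+ d.
Proof.
rewrite {1}/gen /= big_cons big_map /= expr0 alg_polyC; congr (_ + _).
rewrite mulr_sumr -sumrN.
under [RHS]eq_bigr do rewrite -sum_words scaler_sumr mulr_sumr -sumrN.
rewrite exchange_big /=; apply: eq_bigr => cs _.
rewrite /Bform linearN linear_sum /= -sumrN scaler_suml; apply: eq_bigr => m _.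
have -> : \prod_(t <- cs) ((m.2 (ev P u t) : K) *: 'X^(internal t)) =
    (\prod_(x <- map (ev P u) cs) (m.2 x : K)) *: 'X^(sumn (map internal cs)).
  elim: cs => [|t cs IH] /=; first by rewrite !big_nil scale1r.
  by rewrite !big_cons IH -scalerAl -scalerAr scalerA exprD.
by rewrite dualZ -!scalerAr exprS scaleNr scalerA mulrC.
Qed.

(** The recursion makes the difference of the two sides divisible by arbitrarily high powers of [X];
    being a fixed polynomial, it is zero. *)
Let gen_trunc_eq l :
  gen_trunc l = (l u : K)%:P - 'X * \sum_(m <- P) (l m.1 : K) *: gen_trunc m.2 ^+ d.
Proof.
apply/eqP; rewrite -subr_eq0; set R := _ - _.
have dvdR h : (k0 <= h)%N -> dvdp 'X^(h.+1) R.
  move=> k0h.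
  have -> : R = (gen_trunc l - gen l h.+1) +
     'X * \sum_(m <- P) (l m.1 : K) *: (gen_trunc m.2 ^+ d - gen m.2 h ^+ d).
    have -> : \sum_(m <- P) (l m.1 : K) *: (gen_trunc m.2 ^+ d - gen m.2 h ^+ d) =
        \sum_(m <- P) (l m.1 : K) *: gen_trunc m.2 ^+ d -
        \sum_(m <- P) (l m.1 : K) *: gen m.2 h ^+ d.
      by rewrite -sumrB; apply: eq_bigr => m _; rewrite scalerBr.
    by rewrite gen_rec /R; ring.
  rewrite dvdp_addr; last first.
    apply: dvdp_trans (gen_truncP l (leqW k0h)); exact: dvdp_exp2l.
  apply: dvdp_mull; apply: (big_ind (dvdp 'X^(h.+1))) => [|x y|m _].
  - exact: dvdp0.
  - exact: dvdp_add.
  by rewrite -mul_polyC; apply: dvdp_mull; rewrite subrXX; apply: dvdp_mulr; apply: gen_truncP.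
apply: contraT => R0.
have := dvdp_leq R0 (dvdR (k0 + size R)%N (leq_addr _ _)).
by rewrite size_polyXn leqNgt ltnS leqW ?leq_addl.
Qed.

(** The functional equation is one of polynomials and not just of power series, so [X] can be set to
    [1]. *)
Lemma formal_inverseP : Ginv + Ev (power_monomials d P) Ginv = u.
Proof.
have E1 l : (gen_trunc l).[1] = l Ginv.
  rewrite /gen_trunc /Ginv horner_sum linear_sum; apply: eq_bigr => t _.
  by rewrite hornerZ hornerXn expr1n mulr1.
apply: hom_sep => l; have := congr1 (horner^~ 1) (gen_trunc_eq l).
rewrite /= E1 hornerD hornerN hornerM hornerX mul1r hornerC horner_sum => E.
rewrite dualD [X in X + _]E -[RHS]addr0 -addrA; congr (_ + _).
rewrite Ev_power linear_sum addrC; apply/eqP; rewrite subr_eq0; apply/eqP.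
by apply: eq_bigr => m _; rewrite /= dualZ hornerZ horner_exp E1 mulrC.
Qed.

End GeneratingPolynomial.

Lemma rinv_formal k0 :
  (forall u h k, (k0 <= k <= h)%N ->
     \sum_(t <- dtrees d h | internal t == k) ev P u t = 0) ->
  rinv (power_monomials d P).
Proof.
move=> H; exists (fun u => \sum_(t <- dtrees d k0 | (internal t < k0)%N) ev P u t); last first.
  by move=> u; apply: formal_inverseP => h k; apply: H.
(* The value zero off the list makes every summand polynomial, as [polymap_sum] asks for all
   indices. *)
pose f t u := if t \in dtrees d k0 then ev P u t else 0.
apply: (@polymap_ext _ _ _
  (fun u => \sum_(t <- [seq t <- dtrees d k0 | (internal t < k0)%N]) f t u)).
  move=> u /=; rewrite -[RHS]big_filter; apply: eq_big_seq => t.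
  by rewrite mem_filter /f => /andP[_ ->].
apply: polymap_sum => t; rewrite /f; case tk: (t \in _); first exact: polymap_ev tk.
exact: polymap_cst.
Qed.

End FormalInverse.

(** The constant [1] in front of each tree value is replaced by the combination of indicators, and
    the sums are exchanged; the real coefficients are embedded in [CC]. *)
Lemma span_sum_ev (V : vectType CC) c k p (P : seq (V * dual V)) (u : V) (r : seq tree) :
  one_in_shuffle_span c.+1 k p ->
  (forall z x, pathform c P p z (nseq (p * c) x) = 0) ->
  uniq r -> (forall t, (t \in r) = dcat c.+1 k t) ->
  \sum_(t <- r) ev P u t = 0.
Proof.
move=> [m [S [lam [HS H1]]]] H Ur rE.
transitivity (\sum_(t <- r) \sum_(i < m)
    real_complex _ (lam i) *: (if S i t then ev P u t else 0)).
  rewrite big_seq [RHS]big_seq; apply: eq_bigr => t; rewrite rE => /H1 E.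
  rewrite -[LHS]scale1r -(rmorph1 (real_complex _)) -E rmorph_sum scaler_suml.
  apply: eq_bigr => i _; rewrite rmorphM rmorph_nat /= -scalerA; congr (_ *: _).
  by case: (S i t); rewrite ?scale1r ?scale0r.
rewrite exchange_big big1 // => i _; rewrite -scaler_sumr -big_mkcond /=.
have [T [v [ds [dT sds vT SE]]]] := HS i.
rewrite (eq_bigl _ _ SE) (shuffle_class_sum dT vT) ?scaler0 // sds; exact: H.
Qed.

Lemma rinv_powers d (V : vectType CC) (P : seq (V * dual V)) :
  (3 <= d)%N ->
  (forall p, (1 <= p)%N -> exists k0, forall k, (k0 <= k)%N -> one_in_shuffle_span d k p) ->
  pkeller (power_monomials d P) -> rinv (power_monomials d P).
Proof.
case: d => // c d3 Hspan kP; set n := \dim {:V}.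
(* Any path length from [n] on makes the path form vanish; the successor keeps it positive even when
   [V] has dimension zero. *)
have [k0 Hk0] := Hspan n.+1 isT.
apply: (@rinv_formal _ _ _ _ k0) => u h k /andP[k0k kh].
rewrite -big_filter; apply: (span_sum_ev _ (Hk0 _ k0k)).
- move=> z x; apply: pathform_nilpotent; first by case: c d3 {kP Hk0 Hspan}.
  move=> {}x h'; rewrite iterS (DEv_nilpotent (d := c.+1) _ _ kP) ?linear0 ?(ltn_trans _ d3) //.
  by apply/allP => _ /mapP[m _ ->]; rewrite /= size_nseq.
- by rewrite filter_uniq ?uniq_dtrees.
by move=> t; rewrite mem_dtrees_eq.
Qed.

(** * Transfer to multivariate polynomials *)

Section MpolyMaps.
Variables (K : numClosedFieldType) (n : nat).
Notation V := 'rV[K]_n.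

Lemma mpoly_ring_ind (Pr : {mpoly K[n]} -> Prop) :
  (forall c, Pr c%:MP) -> (forall i, Pr 'X_i) ->
  (forall p q, Pr p -> Pr q -> Pr (p + q)) -> (forall p q, Pr p -> Pr q -> Pr (p * q)) ->
  forall p, Pr p.
Proof.
move=> PC PX PD PM; elim/mpolyind => [|c m p _ _ Pp]; first by rewrite -mpolyC0.
apply: (PD) Pp; rewrite -mul_mpolyC; apply: (PM); first exact: PC.
rewrite mpolyXE_id; apply: big_ind => [|p' q|i _]; [by rewrite -mpolyC1|exact: PM|].
by elim: (m i) => [|k IH]; rewrite ?expr0 -?mpolyC1 // exprS; apply: PM.
Qed.

Lemma mnm_submm (m : 'X_{1..n}) : (m - m = 0)%MM.
Proof. by apply/mnmP => i; rewrite mnmBE mnm0E subnn. Qed.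

Definition row_coord i (x : V) : K^o := x 0 i.
Lemma row_coord_is_linear i : linear (row_coord i).
Proof. by move=> c x y; rewrite /row_coord !mxE. Qed.
HB.instance Definition _ i :=
  GRing.isLinear.Build K V K^o _ (row_coord i) (row_coord_is_linear i).

Lemma mpoly_monomials (p : {mpoly K[n]}) : exists L : seq (K^o * seq (dual V)),
  (forall x, Ev L x = p.@[x 0]) /\
  (forall x h, DEv L x h = \sum_j (p^`M(j)).@[x 0] * h 0 j).
Proof.
elim/mpoly_ring_ind: p => [c|i|p q [L1 [E1 D1]] [L2 [E2 D2]]|p q [L1 [E1 D1]] [L2 [E2 D2]]].
- exists [:: (c : K^o, [::])]; split=> [x|x h].
    by rewrite Ev_cons Ev_nil mev_nil scale1r addr0 mevalC.
  rewrite DEv_cons DEv_nil /= scale0r addr0 big1 // => j _.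
  by rewrite mderivC meval0 mul0r.
- exists [:: (1 : K^o, [:: linfun (row_coord i)])]; split=> [x|x h].
    by rewrite Ev_cons Ev_nil mev_cons mev_nil lfunE mevalXU /= mulr1 addr0 /GRing.scale /= mulr1.
  rewrite DEv_cons DEv_nil /= mev_nil mulr0 mulr1 !addr0 lfunE /GRing.scale /= mulr1.
  rewrite (bigD1 i) //= big1 => [|j ji]; rewrite mderivX mevalZ mnm1E.
    by rewrite eqxx mul1r mnm_submm mpolyX0 meval1 mul1r addr0.
  by rewrite eq_sym (negPf ji) !mul0r.
- exists (L1 ++ L2); split=> [x|x h]; first by rewrite Ev_cat E1 E2 mevalD.
  rewrite DEv_cat D1 D2 -big_split; apply: eq_bigr => j _.
  by rewrite mderivD mevalD mulrDl.
pose mul (m1 m2 : K^o * seq (dual V)) : K^o * seq (dual V) :=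
  ((m1.1 : K) * (m2.1 : K), m1.2 ++ m2.2).
exists (allpairs mul L1 L2); split=> [x|x h].
  rewrite mevalM -E1 -E2 /Ev big_allpairs_dep mulr_suml; apply: eq_bigr => m1 _.
  rewrite mulr_sumr; apply: eq_bigr => m2 _.
  by rewrite mev_cat /GRing.scale /=; ring.
transitivity ((DEv L1 x h : K) * Ev L2 x + (Ev L1 x : K) * DEv L2 x h); last first.
  rewrite D1 D2 E1 E2 mulr_suml mulr_sumr -big_split; apply: eq_bigr => j _ /=.
  by rewrite mderivM mevalD !mevalM; ring.
rewrite /DEv /Ev big_allpairs_dep !mulr_suml -big_split; apply: eq_bigr => m1 _ /=.
rewrite !mulr_sumr -big_split; apply: eq_bigr => m2 _ /=.
by rewrite dmev_cat /GRing.scale /=; ring.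
Qed.

Lemma mderiv_vanish (p : {mpoly K[n]}) i :
  (forall x : V, p.@[x 0] = 0) -> forall x : V, (p^`M(i)).@[x 0] = 0.
Proof.
move=> H x; have [L [EL DL]] := mpoly_monomials p.
have := @DEv_unique _ _ _ L [::] _ x (delta_mx 0 i); rewrite DL DEv_nil => <- => [|y].
  rewrite (bigD1 i) //= big1 => [|j ji]; first by rewrite mxE !eqxx mulr1 addr0.
  by rewrite mxE (negPf ji) andbF mulr0.
by rewrite EL H Ev_nil.
Qed.

Lemma meval_at0 (p : {mpoly K[n]}) : p.@[(0 : V) 0] = p@_0%MM.
Proof.
elim/mpoly_ring_ind: p => [c|i|p q Ep Eq|p q Ep Eq].
- by rewrite mcoeffC eqxx mulr1 mevalC.
- by rewrite mcoeffX mevalXU mxE mnm1_eq0.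
- by rewrite mcoeffD mevalD Ep Eq.
by rewrite mevalM Ep Eq (rmorphM (mcoeff 0%MM)).
Qed.

(** The constant coefficient is the value at the origin; any other coefficient appears, up to a
    positive integer factor, at a smaller exponent of a partial derivative, which vanishes
    everywhere too. *)
Lemma mpoly_vanish (p : {mpoly K[n]}) : (forall x : V, p.@[x 0] = 0) -> p = 0.
Proof.
move=> H; apply/mpolyP => m; rewrite mcoeff0.
have [k] := ubnP (mdeg m); elim: k m p H => // k IH m p H /ltnSE mk.
have [->|m0] := eqVneq m 0%MM; first by rewrite -meval_at0 H.
have [i mi] : exists i, m i != 0%N.
  apply/existsP; apply: contraNT m0 => /existsPn Hm.
  by apply/eqP/mnmP => i; rewrite mnm0E; have /negbNE/eqP := Hm i.
have le : (U_(i) <= m)%MM by rewrite lep1mP.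
have E : (p^`M(i))@_(m - U_(i)) = 0.
  apply: IH; first exact: mderiv_vanish.
  by apply: leq_trans mk; rewrite -{2}(submK le) mdegD mdeg1 addn1.
by move/eqP: E; rewrite mcoeff_mderiv submK // mulrn_eq0 /= => /eqP.
Qed.

Lemma ispoly_mpoly (f : V -> K) : ispoly f -> exists p : {mpoly K[n]}, forall x, f x = p.@[x 0].
Proof.
elim=> [c|l|f1 f2 _ [p1 E1] _ [p2 E2]|f1 f2 _ [p1 E1] _ [p2 E2]|f1 f2 e _ [p E]].
- by exists c%:MP => x; rewrite mevalC.
- exists (\sum_j (l (delta_mx 0 j) : K) *: 'X_j) => x.
  rewrite {1}(row_sum_delta x) linear_sum raddf_sum; apply: eq_bigr => j _ /=.
  by rewrite dualZ mevalZ mevalXU mulrC.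
- by exists (p1 + p2) => x; rewrite mevalD E1 E2.
- by exists (p1 * p2) => x; rewrite mevalM E1 E2.
by exists p => x; rewrite -e.
Qed.

Lemma mderiv_comp k (lq : n.-tuple {mpoly K[k]}) (p : {mpoly K[n]}) j :
  (p \mPo lq)^`M(j) = \sum_i (p^`M(i) \mPo lq) * (tnth lq i)^`M(j).
Proof.
elim/mpoly_ring_ind: p => [c|i|p q Ep Eq|p q Ep Eq].
- rewrite comp_mpolyC mderivC big1 // => i _.
  by rewrite mderivC comp_mpoly0 mul0r.
- rewrite comp_mpolyXU -tnth_nth (bigD1 i) //= big1 => [|l li]; rewrite mderivX mnm1E.
    by rewrite eqxx scale1r mnm_submm mpolyX0 comp_mpoly1 mul1r addr0.
  by rewrite eq_sym (negPf li) scale0r comp_mpoly0 mul0r.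
- rewrite comp_mpolyD mderivD Ep Eq -big_split; apply: eq_bigr => i _.
  by rewrite mderivD comp_mpolyD mulrDl.
rewrite rmorphM mderivM Ep Eq mulr_suml mulr_sumr -big_split; apply: eq_bigr => i _ /=.
by rewrite mderivM comp_mpolyD !rmorphM /=; ring.
Qed.

Lemma comp_mpolyA k l (lq : n.-tuple {mpoly K[k]}) (lr : k.-tuple {mpoly K[l]}) p :
  (p \mPo lq) \mPo lr = p \mPo [tuple tnth lq i \mPo lr | i < n].
Proof.
elim/mpoly_ring_ind: p => [c|i|p q Ep Eq|p q Ep Eq].
- by rewrite !comp_mpolyC.
- by rewrite !comp_mpolyXU -!tnth_nth tnth_mktuple.
- by rewrite !comp_mpolyD Ep Eq.
by rewrite !rmorphM /= Ep Eq.
Qed.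

(** By associativity [F] is the composition of [F], [G] and [G'], which is [G']. *)
Lemma comp_inverse_unique (F G G' : 'I_n -> {mpoly K[n]}) :
  (forall i, F i \mPo [tuple G j | j < n] = 'X_i) ->
  (forall i, G i \mPo [tuple G' j | j < n] = 'X_i) ->
  F =1 G'.
Proof.
move=> FG GG' i; set t := [tuple G j | j < n] in FG; set t' := [tuple G' j | j < n] in GG'.
have E : [tuple tnth t j \mPo t' | j < n] = [tuple 'X_j | j < n].
  by apply: eq_from_tnth => j; rewrite !tnth_mktuple GG'.
have := comp_mpolyA t t' (F i); rewrite E comp_mpoly_id FG => <-.
by rewrite comp_mpolyXU -tnth_nth tnth_mktuple.
Qed.

End MpolyMaps.

(** * Keller maps *)

Section Normalize.
Variables (K : numClosedFieldType) (V : vectType K) (L : seq (V * seq (dual V))).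
Hypothesis injL : forall x h, DEv L x h = 0 -> h = 0.
Hypothesis reduced : forall L' : seq (V * seq (dual V)),
  all (fun m => 1 < size m.2)%N L' -> pkeller L' -> rinv L'.

Let L0 := [seq m <- L | size m.2 == 0%N].
Let R := [seq m <- L | size m.2 != 0%N].
Let L1 := [seq m <- R | size m.2 == 1%N].
Let L2 := [seq m <- R | size m.2 != 1%N].

Let permL : perm_eq (L0 ++ L1 ++ L2) L.
Proof.
apply: (@perm_trans _ (L0 ++ R)); last by rewrite perm_filterC.
by rewrite perm_cat2l; apply/permPl/perm_filterC.
Qed.

Let size_L2 m : m \in L2 -> (1 < size m.2)%N.
Proof. by rewrite !mem_filter => /and3P[]; case: (size m.2) => [|[]]. Qed.

Let L0E x : Ev L0 x = Ev L0 0.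
Proof.
rewrite /Ev big_seq [RHS]big_seq; apply: eq_bigr => m.
by rewrite mem_filter => /andP[/nilP-> _]; rewrite !mev_nil.
Qed.

Let L0D x h : DEv L0 x h = 0.
Proof.
rewrite /DEv big_seq big1 // => m; rewrite mem_filter => /andP[/nilP-> _].
by rewrite scale0r.
Qed.

Let L1E x h : DEv L1 x h = Ev L1 h.
Proof.
rewrite /DEv /Ev big_seq [RHS]big_seq; apply: eq_bigr => m.
rewrite mem_filter => /andP[s1 _]; case: m.2 s1 => [|l []] //= _.
by rewrite mev_cons !mev_nil mulr0 addr0.
Qed.

Let L2D h : DEv L2 0 h = 0.
Proof.
rewrite /DEv big_seq big1 // => m /size_L2 s2.
have := dmevZ m.2 0 0 h; rewrite scale0r => ->.
by case: (size m.2) s2 => [|[|k]] // _; rewrite exprS !mul0r scale0r.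
Qed.

Let LE x : Ev L x = Ev L0 0 + (Ev L1 x + Ev L2 x).
Proof. by rewrite -(Ev_perm _ permL) !Ev_cat L0E. Qed.

Let LD x h : DEv L x h = Ev L1 h + DEv L2 x h.
Proof. by rewrite -(DEv_perm _ _ permL) !DEv_cat L0D L1E add0r. Qed.

Let M : 'End(V) := linfun (DEv L1 0).

Let ME h : M h = Ev L1 h.
Proof. by rewrite lfunE /= L1E. Qed.

(** Terms of degree at least two have zero derivative at the origin, so the derivative of the whole
    map there is [M]. *)
Let kerM : lker M == 0%VS.
Proof.
apply/lker0P => x y E; apply/eqP; rewrite -subr_eq0; apply/eqP/(injL (x := 0)).
by rewrite LD L2D addr0 -ME linearB /= E subrr.
Qed.

(** The inverse of [M] applied to the map minus its constant term is the identity plus terms of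
    degree at least two, and its derivative is still injective. *)
Lemma right_inverse : exists2 G : V -> V, polymap G & forall u, Ev L (G u) = u.
Proof.
pose L' := [seq ((M^-1)%VF m.1, m.2) | m <- L2].
have E' x : Ev L' x = (M^-1)%VF (Ev L2 x).
  by rewrite /Ev big_map linear_sum; apply: eq_bigr => m _; rewrite linearZ.
have D' x h : DEv L' x h = (M^-1)%VF (DEv L2 x h).
  by rewrite /DEv big_map linear_sum; apply: eq_bigr => m _; rewrite linearZ.
have [|x h E|G PG EG] := reduced (L' := L').
- by rewrite all_map; apply/allP => m /size_L2.
- apply: (injL (x := x)); rewrite LD -ME.
  by have /(congr1 M) := E; rewrite linearD linear0 D' /= lker0_lfunVK.
exists (fun v => G ((M^-1)%VF (v - Ev L0 0))).
  apply: (polymap_comp PG).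
  have PM := polymapD (polymap_hom (M^-1)%VF) (polymap_cst V (- (M^-1)%VF (Ev L0 0))).
  apply: polymap_ext PM => v.
  by rewrite linearB.
move=> v; have /(congr1 M) := EG ((M^-1)%VF (v - Ev L0 0)).
rewrite E' linearD /= !lker0_lfunVK // LE -ME => ->.
by rewrite addrC subrK.
Qed.
End Normalize.

Section KellerMaps.
Hypothesis reduced : forall (V : vectType CC) (L : seq (V * seq (dual V))),
  all (fun m => 1 < size m.2)%N L -> pkeller L -> rinv L.
Variable n : nat.
Implicit Types F G : 'I_n -> {mpoly CC[n]}.
Notation V := 'rV[CC]_n.

Lemma jacobian_mul F (x h : V) :
  keller_map F -> (forall i, \sum_j ((F i)^`M(j)).@[x 0] * h 0 j = 0) -> h = 0.
Proof.
move=> [c [c0 Fc]] H; pose J := map_mx (meval (x 0)) (jacobian F).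
have uJ : J \in unitmx by rewrite unitmxE det_map_mx Fc /= mevalC unitfE.
have : J *m h^T = 0.
  apply/matrixP => i j; rewrite !mxE -[RHS](H i) ord1; apply: eq_bigr => k _.
  by rewrite !mxE.
move/(congr1 (mulmx (invmx J))); rewrite mulKmx // mulmx0 => /(congr1 trmx).
by rewrite trmxK trmx0.
Qed.

Lemma keller_right_inverse F : keller_map F -> exists G, forall i, Defs.pcomp F G i = 'X_i.
Proof.
move=> kF; have [Ls HL] := fin_all_exists (fun i : 'I_n => mpoly_monomials (F i)).
pose L : seq (V * seq (dual V)) :=
  flatten [seq [seq ((m.1 : CC) *: delta_mx 0 i, m.2) | m <- Ls i] | i : 'I_n].
have EL x i : (Ev L x) 0 i = (F i).@[x 0].
  rewrite -(proj1 (HL i)) /Ev big_flatten big_image summxE (bigD1 i) //=.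
  rewrite big_map summxE [X in _ + X]big1 => [|j ji]; last first.
    rewrite big_map summxE big1 // => m _.
    by rewrite !mxE eq_sym (negPf ji) andbF !mulr0.
  by rewrite addr0; apply: eq_bigr => m _; rewrite !mxE !eqxx mulr1.
have DL x h i : (DEv L x h) 0 i = \sum_j ((F i)^`M(j)).@[x 0] * h 0 j.
  rewrite -(proj2 (HL i)) /DEv big_flatten big_image summxE (bigD1 i) //=.
  rewrite big_map summxE [X in _ + X]big1 => [|j ji]; last first.
    rewrite big_map summxE big1 // => m _.
    by rewrite !mxE eq_sym (negPf ji) andbF !mulr0.
  by rewrite addr0; apply: eq_bigr => m _; rewrite !mxE !eqxx mulr1.
have [x h E|G PG EG] := @right_inverse _ _ L _ (reduced (V := V)).
  by apply: (jacobian_mul kF (x := x)) => i; rewrite -DL E mxE.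
have [p Hp] := fin_all_exists (fun i : 'I_n => ispoly_mpoly (PG (linfun (row_coord i)))).
(* Equality of values at all points is turned into equality of polynomials. *)
exists p => i; apply/eqP; rewrite -subr_eq0; apply/eqP/mpoly_vanish => x.
rewrite mevalB mevalXU /Defs.pcomp comp_mpoly_meval -[x in X in _ - X]EG EL.
apply/eqP; rewrite subr_eq0; apply/eqP/meval_eq => j.
by rewrite tnth_mktuple -Hp lfunE.
Qed.

(** By the chain rule [det JF], composed with [G], times [det JG] is [1], and the first factor is
    the constant [c]. *)
Lemma keller_of_right_inverse F G :
  keller_map F -> (forall i, Defs.pcomp F G i = 'X_i) -> keller_map G.
Proof.
move=> [c [c0 Fc]] FG; exists c^-1; split; first by rewrite invr_eq0.
pose t := [tuple G j | j < n].
have E : map_mx (comp_mpoly t) (jacobian F) *m jacobian G = 1%:M.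
  apply/matrixP => i j; rewrite !mxE.
  transitivity ((F i \mPo t)^`M(j)).
    by rewrite mderiv_comp; apply: eq_bigr => k _; rewrite !mxE tnth_mktuple.
  rewrite -/(Defs.pcomp F G i) FG mderivX mnm1E; case: eqP => [->|_].
    by rewrite mnm_submm mpolyX0 scale1r.
  by rewrite scale0r.
have := congr1 determinant E; rewrite det_mulmx det1 det_map_mx Fc /= comp_mpolyC => Ec.
by rewrite -[RHS]mulr1 -Ec mulrA -mpolyCM mulVf // mpolyC1 mul1r.
Qed.

Lemma keller_automorphism F : keller_map F -> poly_automorphism F.
Proof.
move=> kF; have [G FG] := keller_right_inverse kF.
have [G' GG'] := keller_right_inverse (keller_of_right_inverse kF FG).
exists G; split; first exact: FG.
move=> i; rewrite -(GG' i) /Defs.pcomp.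
(* The right inverse [G'] of [G] coincides with [F]. *)
by have -> : [tuple F j | j < n] = [tuple G' j | j < n]
  by apply: eq_mktuple; apply: comp_inverse_unique FG GG'.
Qed.

End KellerMaps.

Local Close Scope ring_scope.

Theorem theorem1p4 :
  (exists d : nat, 3 <= d /\
     forall p : nat, 1 <= p ->
       exists k0 : nat, forall k : nat, k0 <= k -> one_in_shuffle_span d k p) ->
  forall n : nat, 1 <= n ->
    forall F : 'I_n -> {mpoly CC[n]}, keller_map F -> poly_automorphism F.
Proof.
move=> [d [d3 Hspan]] n _ F; apply: keller_automorphism => V L.
apply: (reduce_to_powers d3) => W P; exact: rinv_powers d3 Hspan.
Qed.
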